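(* If $R$ is a commutative ring, then $\mathsf{GIac}\text{-}\mathrm{gldim}\,R=\mathsf{GPac}\text{-}\mathrm{gldim}\,R$.
   Context: All rings are associative; an $R$-module is a left $R$-module, and right $R$-modules are modules over the opposite ring $R^\circ$. A module $F$ is of type $\mathrm{FP}_\infty$ if it has a projective resolution by finitely generated projective modules. A left $R$-module $A$ is absolutely clean if $\mathrm{Ext}^1_R(F,A)=0$ for all left $R$-modules $F$ of type $\mathrm{FP}_\infty$. A left $R$-module $L$ is level if $\mathrm{Tor}_1^R(F,L)=0$ for all right $R$-modules $F$ of type $\mathrm{FP}_\infty$. An $R$-module $M$ is Gorenstein AC-projective if there is an exact sequence $\cdots\to P_1\to P_0\to P_{-1}\to\cdots$ of projective $R$-modules with $M\cong\mathrm{Coker}(P_1\to P_0)$ that remains exact after applying $\mathrm{Hom}_R(-,L)$ for each level $R$-module $L$. $M$ is Gorenstein AC-injective if there is an exact sequence $\cdots\to I_1\to I_0\to I_{-1}\to\cdots$ of injective $R$-modules with $M\cong\mathrm{Coker}(I_1\to I_0)$ that remains exact after applying $\mathrm{Hom}_R(A,-)$ for each absolutely clean $R$-module $A$. The Gorenstein AC-projective dimension of $M$ is $\le n$ iff there is an exact sequence $0\to G_n\to\cdots\to G_0\to M\to0$ with each $G_i$ Gorenstein AC-projective; the Gorenstein AC-injective dimension is $\le n$ iff there is an exact sequence $0\to M\to G^0\to\cdots\to G^n\to0$ with each $G^i$ Gorenstein AC-injective. $\mathsf{GPac}\text{-}\mathrm{gldim}\,R$ and $\mathsf{GIac}\text{-}\mathrm{gldim}\,R$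 (possibly $\infty$) denote the suprema over all $R$-modules of the Gorenstein AC-projective and Gorenstein AC-injective dimensions, respectively. *)

(* Defs.v *)
From HB Require Import structures.
From mathcomp Require Import all_boot all_algebra boolp.
From mathcomp.multinomials Require Import freeg.

Set Implicit Arguments.
Unset Strict Implicit.
Unset Printing Implicit Defensive.

Import GRing.Theory.
Local Open Scope ring_scope.
Local Open Scope quotient_scope.

(* Rings are associative and unital, possibly zero ([pzRingType]). [lmodType R]
   is the type of left R-modules; right R-modules are left modules over the
   opposite ring R^c, so that m.r is written (r : R^c) *: m. *)

(* M (x)_R N: the free abelian group on M * N modulo the subgroup spanned by
   the biadditivity and balancedness relations. *)
Section Tensor.
Variable R : pzRingType.

Section Construction.
Variables (M : lmodType R^c) (N : lmodType R).

Definition tgen (m : M) (n : N) : {freeg (M * N)%type} := << (m, n) >>.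

Inductive tensor_rel : {freeg (M * N)%type} -> Prop :=
| TRelDl m m' n : tensor_rel (tgen (m + m') n - (tgen m n + tgen m' n))
| TRelDr m n n' : tensor_rel (tgen m (n + n') - (tgen m n + tgen m n'))
| TRelZ m (r : R) n : tensor_rel (tgen ((r : R^c) *: m) n - tgen m (r *: n))
| TRel0 : tensor_rel 0
| TRelB x y : tensor_rel x -> tensor_rel y -> tensor_rel (x - y).

Definition tensor_relb : {pred {freeg (M * N)%type}} :=
  fun x => `[< tensor_rel x >].

Lemma tensor_relb_zmod_closed : zmod_closed tensor_relb.
Proof.
split=> [|x y /asboolP Tx /asboolP Ty]; apply/asboolP; first exact: TRel0.
exact: TRelB.
Qed.

HB.instance Definition _ :=
  GRing.isZmodClosed.Build _ tensor_relb tensor_relb_zmod_closed.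

Definition tensor := Quotient.quot tensor_relb.
HB.instance Definition _ := GRing.Zmodule.on tensor.

Definition tpure (m : M) (n : N) : tensor := \pi_tensor (tgen m n).

End Construction.

(* f (x) N, which sends m (x) n to f m (x) n; see [tensor_map_pure]. *)
Section Functoriality.
Variables (M M' : lmodType R^c) (N : lmodType R) (f : {linear M -> M'}).

Definition freeg_map : {freeg (M * N)%type} -> {freeg (M' * N)%type} :=
  fglift (fun mn => tgen (f mn.1) mn.2).

Definition tensor_map (t : tensor M N) : tensor M' N :=
  \pi_(tensor M' N) (freeg_map (repr t)).

Lemma freeg_mapB x y : freeg_map (x - y) = freeg_map x - freeg_map y.
Proof. exact: lift_is_additive. Qed.

Lemma freeg_map_gen m n : freeg_map (tgen m n) = tgen (f m) n.
Proof. by rewrite /freeg_map liftU scale1r. Qed.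

Lemma freeg_map_rel x : tensor_rel x -> tensor_rel (freeg_map x).
Proof.
have f0 : freeg_map 0 = 0 by rewrite -(subrr 0) freeg_mapB subrr.
have fD a b : freeg_map (a + b) = freeg_map a + freeg_map b.
  by rewrite -{1}[b]opprK -[- b]sub0r !(freeg_mapB, f0) sub0r opprK.
elim=> [m m' n|m n n'|m r n||a b _ Ta _ Tb].
- by rewrite freeg_mapB fD !freeg_map_gen linearD; apply: TRelDl.
- by rewrite freeg_mapB fD !freeg_map_gen; apply: TRelDr.
- by rewrite freeg_mapB !freeg_map_gen linearZ; apply: TRelZ.
- by rewrite f0; apply: TRel0.
- by rewrite freeg_mapB; apply: TRelB.
Qed.

Lemma tensor_map_pi x :
  tensor_map (\pi_(tensor M N) x) = \pi_(tensor M' N) (freeg_map x).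
Proof.
apply/eqP; rewrite /tensor_map -Quotient.idealrBE -freeg_mapB.
apply/asboolP/freeg_map_rel/asboolP.
by have := Quotient.idealrBE (@tensor_relb M N) (repr (\pi_(tensor M N) x)) x;
  rewrite reprK eqxx.
Qed.

Lemma tensor_map_is_zmod_morphism : zmod_morphism tensor_map.
Proof.
move=> s t; rewrite -[s]reprK -[t]reprK.
have piB (V : lmodType R^c) x y :
    \pi_(tensor V N) (x - y) = \pi_(tensor V N) x - \pi_(tensor V N) y.
  exact: pi_is_zmod_morphism.
by rewrite -piB !tensor_map_pi freeg_mapB piB.
Qed.

HB.instance Definition _ :=
  GRing.isZmodMorphism.Build _ _ tensor_map tensor_map_is_zmod_morphism.

Lemma tensor_map_pure m n : tensor_map (tpure m n) = tpure (f m) n.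
Proof. by rewrite /tpure tensor_map_pi freeg_map_gen. Qed.

End Functoriality.
End Tensor.

Section Modules.
Variable R : pzRingType.
Implicit Types M N F L A : lmodType R.

Definition exact_at (U V W : zmodType) (f : U -> V) (g : V -> W) : Prop :=
  forall y, g y = 0 <-> exists x, f x = y.

Definition surj (T U : Type) (f : T -> U) : Prop := forall y, exists x, f x = y.

(* Exactness at Hom(V, L) of Hom(W, L) -> Hom(V, L) -> Hom(U, L), for a complex
   U -> V -> W. *)
Definition hom_to_exact (U V W : lmodType R)
    (f : {linear U -> V}) (g : {linear V -> W}) L : Prop :=
  forall h : {linear V -> L}, (forall x, h (f x) = 0) ->
    exists k : {linear W -> L}, forall y, k (g y) = h y.

(* Exactness at Hom(A, V) of Hom(A, U) -> Hom(A, V) -> Hom(A, W), for a complex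
   U -> V -> W. *)
Definition hom_from_exact A (U V W : lmodType R)
    (f : {linear U -> V}) (g : {linear V -> W}) : Prop :=
  forall h : {linear A -> V}, (forall a, g (h a) = 0) ->
    exists k : {linear A -> U}, forall a, f (k a) = h a.

Definition projective (P : lmodType R) : Prop :=
  forall M N (g : {linear M -> N}) (h : {linear P -> N}), surj g ->
    exists k : {linear P -> M}, forall x, g (k x) = h x.

Definition injective_module (I : lmodType R) : Prop :=
  forall M N (g : {linear M -> N}) (h : {linear M -> I}), injective g ->
    exists k : {linear N -> I}, forall x, k (g x) = h x.

Definition finitely_generated M : Prop :=
  exists (n : nat) (e : 'I_n -> M),
    forall x, exists c : 'I_n -> R, x = \sum_i c i *: e i.

Definition is_resolution M (P : nat -> lmodType R)
    (d : forall i, {linear P i.+1 -> P i}) (eps : {linear P 0%N -> M}) : Prop :=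
  [/\ surj eps, exact_at (d 0%N) eps & forall i, exact_at (d i.+1) (d i)].

Definition is_coresolution M (I : nat -> lmodType R)
    (d : forall i, {linear I i -> I i.+1}) (eta : {linear M -> I 0%N}) : Prop :=
  [/\ injective eta, exact_at eta (d 0%N) & forall i, exact_at (d i) (d i.+1)].

Definition FP_infty F : Prop :=
  exists (P : nat -> lmodType R) (d : forall i, {linear P i.+1 -> P i})
    (eps : {linear P 0%N -> F}), is_resolution d eps /\
    forall i, projective (P i) /\ finitely_generated (P i).

(* Ext^1_R(F, A) = 0. The cohomology of Hom(P, A) does not depend on the
   projective resolution P of F. *)
Definition Ext1_eq0 F A : Prop :=
  forall (P : nat -> lmodType R) (d : forall i, {linear P i.+1 -> P i})
    (eps : {linear P 0%N -> F}),
    is_resolution d eps -> (forall i, projective (P i)) ->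
    hom_to_exact (d 1%N) (d 0%N) A.

Definition absolutely_clean A : Prop := forall F, FP_infty F -> Ext1_eq0 F A.

End Modules.

(* Tor_1^R(F, L) = 0, computed from projective resolutions of the right module
   F; the homology of P (x) L does not depend on the resolution P. *)
Definition Tor1_eq0 (R : pzRingType) (F : lmodType R^c) (L : lmodType R) :
    Prop :=
  forall (P : nat -> lmodType R^c) (d : forall i, {linear P i.+1 -> P i})
    (eps : {linear P 0%N -> F}),
    is_resolution d eps -> (forall i, projective (P i)) ->
    exact_at (tensor_map (N := L) (d 1%N)) (tensor_map (N := L) (d 0%N)).

Definition level (R : pzRingType) (L : lmodType R) : Prop :=
  forall F : lmodType R^c, FP_infty F -> Tor1_eq0 F L.

Section GorensteinAC.
Variable R : pzRingType.
Implicit Types M L A : lmodType R.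

(* In a complex indexed by the integers the differential out of degree i + 1 is
   d i : C (i + 1) -> C i; every integer has the form i + 1, so this covers
   every degree. *)
Definition acyclic (C : int -> lmodType R)
    (d : forall i, {linear C (i + 1) -> C i}) : Prop :=
  forall i, exact_at (d (i + 1)) (d i).

Definition is_coker (U V W : lmodType R)
    (f : {linear U -> V}) (p : {linear V -> W}) : Prop :=
  surj p /\ exact_at f p.

Definition GAC_projective M : Prop :=
  exists (P : int -> lmodType R) (d : forall i, {linear P (i + 1) -> P i})
    (p : {linear P 0 -> M}),
  [/\ acyclic d, (forall i, projective (P i)), is_coker (d 0) p
    & forall L, level L -> forall i, hom_to_exact (d (i + 1)) (d i) L].

Definition GAC_injective M : Prop :=
  exists (I : int -> lmodType R) (d : forall i, {linear I (i + 1) -> I i})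
    (p : {linear I 0 -> M}),
  [/\ acyclic d, (forall i, injective_module (I i)), is_coker (d 0) p
    & forall A, absolutely_clean A ->
        forall i, hom_from_exact A (d (i + 1)) (d i)].

Definition zero_module M : Prop := forall x : M, x = 0.

(* The sequence 0 -> G_n -> ... -> G_0 -> M -> 0 is continued by zero modules
   beyond G_n, and likewise for coresolutions. *)
Definition GPac_dim_le M (n : nat) : Prop :=
  exists (G : nat -> lmodType R) (d : forall i, {linear G i.+1 -> G i})
    (eps : {linear G 0%N -> M}), [/\ is_resolution d eps,
    forall i, (i <= n)%N -> GAC_projective (G i)
    & forall i, (n < i)%N -> zero_module (G i)].

Definition GIac_dim_le M (n : nat) : Prop :=
  exists (G : nat -> lmodType R) (d : forall i, {linear G i -> G i.+1})
    (eta : {linear M -> G 0%N}), [/\ is_coresolution d eta,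
    forall i, (i <= n)%N -> GAC_injective (G i)
    & forall i, (n < i)%N -> zero_module (G i)].

End GorensteinAC.

(* Dimensions take values in [option nat], where [None] stands for infinity. *)
Definition least (P : nat -> Prop) : option nat :=
  if pselect (exists n, `[< P n >]) is left exP then Some (ex_minn exP)
  else None.

Definition dim_leq (d : option nat) (n : nat) : bool :=
  if d is Some k then (k <= n)%N else false.

(* The supremum of a family is its least upper bound, infinite when there is no
   finite one. *)
Definition dim_sup (T : Type) (dim : T -> option nat) : option nat :=
  least (fun n => forall x, dim_leq (dim x) n).

Definition GPac_dim (R : pzRingType) (M : lmodType R) : option nat :=
  least (GPac_dim_le M).

Definition GIac_dim (R : pzRingType) (M : lmodType R) : option nat :=
  least (GIac_dim_le M).

Definition GPac_gldim (R : pzRingType) : option nat := dim_sup (@GPac_dim R).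

Definition GIac_gldim (R : pzRingType) : option nat := dim_sup (@GIac_dim R).

(* Main.v *)
From HB Require Import structures.
From mathcomp Require Import all_boot all_order all_algebra.
From mathcomp Require Import boolp classical_sets functions.
From mathcomp.multinomials Require Import freeg.
Require Import Defs.

(** Write M^+ for the character module Hom_Z(M, Q/Z), again an R-module because
    R is commutative.  Two facts about it carry the proof: L is level exactly
    when L^+ is absolutely clean (tensor-hom adjunction, [level_dualP]), and for
    F of type FP_oo the group Ext^1(F, A) vanishes exactly when Ext^1(F, A^{++})
    does ([FP_infty_bidual]), so that A^+ is level when A is absolutely clean.

    Suppose that all Gorenstein AC-projective dimensions are at most n.
    Dimension shifting gives Ext^{n+1}(M, L) = 0 for every M and every level L
    ([gdim_ext]): level modules, in particular projective ones, have injective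
    dimension at most n.  Every module A embeds into a module H of projective
    dimension at most n with Gorenstein AC-projective cokernel G
    ([gdim_approx]); if A has a finite resolution by level modules, then
    Ext^1(G, A) = 0, the embedding splits, and A itself has projective dimension
    at most n ([gdim_tres_ext]).  An absolutely clean A has such a resolution:
    A^+ is level, hence of injective dimension at most n, so the dual of an n-th
    syzygy K of A is injective and K is level ([level_resolution]).

    So absolutely clean modules have projective dimension at most n, and
    projective modules have injective dimension at most n.  This forces the n-th
    cosyzygy Z of any module M to be Gorenstein AC-injective.  An injective
    coresolution of Z is one half of the required complex.  For the other half,
    the horseshoe lemma turns the short exact sequences of a projective
    resolution of M into short exact sequences of n-th cosyzygies, whose middle
    terms are injective ([syz_ses], [gdim_all]).  Hence all Gorenstein
    AC-injective dimensions are at most n.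

    The converse is dual except for the resolution: if L is level, then L^+ has
    projective dimension at most n, so L^{++} has injective dimension at most n,
    so Ext^{n+1}(F, L) = 0 for F of type FP_oo, and the n-th cosyzygy of L is
    absolutely clean ([absolutely_clean_coresolution]).

    To prove each step once, the homological algebra is done for a relation of
    short exact sequences and a relation of Ext^1-vanishing subject to a
    self-dual list of axioms; the injective statements are the projective ones
    in the opposite structure.  A complete resolution enters through its
    cycles: [gac] is the largest class of objects X that have the vanishing
    property and embed into a projective with cokernel in the class. *)

Set Implicit Arguments.
Unset Strict Implicit.
Unset Printing Implicit Defensive.
Import Order.TTheory GRing.Theory Num.Theory.

(** * Homological algebra with short exact sequences only *)

(** [ses A B C] stands for the existence of a short exact sequence from A to B
    to C, and [orth X Y] for Ext^1(X, Y) = 0. *)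
Record ext_data := ExtData {
  obj :> Type;
  ses : obj -> obj -> obj -> Prop;
  orth : obj -> obj -> Prop
}.

Definition op (D : ext_data) : ext_data :=
  ExtData (fun A B C => @ses D C B A) (fun X Y => @orth D Y X).

Definition proj (D : ext_data) (P : D) := forall Y, orth P Y.
Definition inj (D : ext_data) (I : D) := forall X, orth X I.

(** Each field is a statement about modules whose dual is also true; [axioms]
    asks for the fields in the structure and in its opposite.  [orth_shift] is
    dimension shifting in both variables at once, [orth_retract] says that A is
    a summand of B when the sequence splits, and [ses_extend] builds a sequence
    with middle term E embedded in the sum of I and J when E is itself the sum
    of I and C. *)
Record half_axioms (D : ext_data) : Prop := HalfAxioms {
  enough_proj : forall X : D, exists K P, proj P /\ ses K P X;
  orth_mid : forall A B C Y : D,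
    ses A B C -> orth A Y -> orth C Y -> orth B Y;
  orth_shift : forall X' P X Y I Y' : D, ses X' P X -> ses Y I Y' ->
    orth P Y' -> orth X I -> orth X' Y -> orth X Y';
  orth_retract : forall A B C Y : D,
    ses A B C -> orth C A -> orth B Y -> orth A Y;
  ses_pushout : forall K G M H G' : D, ses K G M -> ses K H G' ->
    exists E, ses G E G' /\ ses H E M;
  ses_quotient : forall H E M P G : D, ses H E M -> ses E P G ->
    exists Q, ses H P Q /\ ses M Q G;
  ses_extend : forall I E C J C' : D, ses I E C -> ses C J C' -> orth C I ->
    exists S, ses I S J /\ ses E S C';
  ses_sum : forall A B : D, exists S, ses A S B
}.

Record axioms (D : ext_data) : Prop := Axs {
  ax_half : half_axioms D;
  ax_half_op : half_axioms (op D)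
}.

Lemma axioms_op (D : ext_data) : axioms D -> axioms (op D).
Proof. by case: D => O s o [h1 h2]; split. Qed.

(** Ext^{n+1}(X, Y) = 0, computed from cosyzygies of Y.  Quantifying over all
    cosyzygies makes the vanishing independent of choices by definition. *)
Fixpoint ext (D : ext_data) n (X Y : D) : Prop :=
  if n is m.+1 then forall I Z, inj I -> ses Y I Z -> ext m X Z else orth X Y.

(** Push A out along its embedding in I: the new middle term E is an extension
    of C by I, hence split, hence embeds in the sum of I and J, and B embeds in
    that sum through E. *)
Lemma horseshoe (D : ext_data) (axD : axioms D) (A B C I A' J C' : D) :
  ses A B C -> ses A I A' ->
  ses C J C' -> orth C I ->
  exists S B', [/\ ses I S J, ses B S B' & ses A' B' C'].
Proof.
case: axD => hD _ ABC AIA CJC oCI.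
have [E [BEA IEC]] := ses_pushout hD ABC AIA.
have [S [ISJ ESC]] := ses_extend hD IEC CJC oCI.
by have [B' []] := ses_quotient hD BEA ESC; exists S, B'.
Qed.

Section Ext.
Variables (D : ext_data) (axD : axioms D).
Let hD := ax_half axD.
Let hD' := ax_half_op axD.

(** By induction on the cosyzygies of Y this reduces to n = 0, which is
    [orth_shift] in one direction and its dual in the other. *)
Lemma ext_shift_proj n (X' P X Y : D) :
  proj P -> ses X' P X -> (ext n X' Y <-> ext n.+1 X Y).
Proof.
move=> pP XPX; elim: n Y => [|n IHn] Y /=; last first.
  by split=> e I Z iI YIZ; apply/IHn => //; apply: e YIZ.
split=> [o I Z iI YIZ|o].
  exact: (orth_shift hD XPX YIZ).
have [Z [I [iI YIZ]]] := enough_proj hD' Y.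
apply: (orth_shift hD' YIZ XPX); [exact: iI|exact: pP|exact: o YIZ].
Qed.

(** Ext can be computed from either variable; this makes [ext] self-dual. *)
Lemma ext_op n (X Y : D) : @ext (op D) n Y X <-> ext n X Y.
Proof.
elim: n X => [|n IHn] X //=; split=> [e|e P X' pP XPX].
  have [X' [P [pP XPX]]] := enough_proj hD X.
  by apply/(ext_shift_proj _ _ pP XPX)/IHn; apply: e XPX.
by apply/IHn/(ext_shift_proj _ _ pP XPX).
Qed.

(** Only the vanishing of Ext(G, Y) is needed to shift dimensions along G, which
    allows resolutions by Gorenstein AC-projective objects. *)
Lemma ext_shift n (X' G X Y : D) :
  ses X' G X -> (forall k, ext k G Y) -> (ext n X' Y <-> ext n.+1 X Y).
Proof.
move=> XGX; elim: n Y => [|n IHn] Y eG /=; last first.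
  have IH I Z iI YIZ := IHn Z (fun k => eG k.+1 I Z iI YIZ).
  by split=> e I Z iI YIZ; apply/(IH I Z iI YIZ); apply: e YIZ.
split=> [o I Z iI YIZ|o].
  by apply: (orth_shift hD XGX YIZ) => //; apply: (eG 1) YIZ.
have [Z [I [iI YIZ]]] := enough_proj hD' Y.
apply: (orth_shift hD' YIZ XGX); [exact: iI|exact: (eG 0)|exact: o YIZ].
Qed.

Lemma ext_mid n (A B C Y : D) :
  ses A B C -> ext n A Y -> ext n C Y -> ext n B Y.
Proof.
move=> ABC; elim: n Y => [|n IHn] Y /=; first exact: (orth_mid hD).
by move=> eA eC I Z iI YIZ; apply: IHn; [apply: eA YIZ|apply: eC YIZ].
Qed.

Lemma ext_retract n (A B C Y : D) :
  ses A B C -> orth C A -> ext n B Y -> ext n A Y.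
Proof.
move=> ABC oCA; elim: n Y => [|n IHn] Y /=; first exact: (orth_retract hD) oCA.
by move=> eB I Z iI YIZ; apply: IHn; apply: eB YIZ.
Qed.

Lemma ext_proj k (P : D) Y : proj P -> ext k P Y.
Proof.
by move=> pP; elim: k Y => [|k IHk] Y //= I Z _ _; apply: IHk.
Qed.

Lemma proj_mid (A B C : D) : ses A B C -> proj A -> proj C -> proj B.
Proof. by move=> ABC pA pC Y; apply: (orth_mid hD) ABC _ _. Qed.

Lemma extS_all n m (Y : D) :
  (forall X, ext n X Y) -> (n <= m)%N -> forall X, ext m X Y.
Proof.
move=> eY /subnKC <-; elim: (m - n)%N => [|k IHk] X; first by rewrite addn0.
have [X' [P [pP XPX]]] := enough_proj hD X.
by rewrite addnS; apply/(ext_shift_proj _ _ pP XPX).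
Qed.

Fixpoint syz n (M Z : D) : Prop :=
  if n is m.+1 then exists K P, [/\ proj P, ses K P M & syz m K Z] else M = Z.

Lemma syz_ex n (M : D) : exists Z, syz n M Z.
Proof.
elim: n M => [|n IHn] M /=; first by exists M.
have [K [P [pP KPM]]] := enough_proj hD M.
by have [Z] := IHn K; exists Z, K, P.
Qed.

Lemma syz_ext n k (M Z Y : D) :
  syz n M Z -> (ext k Z Y <-> ext (k + n) M Y).
Proof.
elim: n M => [|n IHn] M /= => [->|]; first by rewrite addn0.
move=> [K [P [pP KPM /IHn ->]]]; rewrite addnS; exact: ext_shift_proj.
Qed.

(** The horseshoe lemma, iterated: it is what produces the part of a complete
    resolution that points away from the projective resolution. *)
Lemma syz_ses n (A B C X : D) : ses A B C -> syz n A X ->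
  exists J X', [/\ syz n B J, syz n C X' & ses X J X'].
Proof.
elim: n A B C => [|n IHn] A B C ABC /=; first by move=> <-; exists B, C.
move=> [A1 [P [pP APA syzX]]].
have [C1 [Q [pQ CQC]]] := enough_proj hD C.
have [S [B1 [QSP BSB ABC1]]] := @horseshoe (op D) (axioms_op axD) _ _ _ _ _ _ _
  ABC CQC APA (pQ A).
have [J [X' [sB sC XJX]]] := IHn _ _ _ ABC1 syzX.
exists J, X'; split=> //.
- by exists B1, S; split=> //; apply: proj_mid QSP _ _.
- by exists C1, Q.
Qed.
End Ext.

Section GAC.
Variables (D : ext_data) (axD : axioms D) (T : D -> Prop).
Hypothesis projT : forall P, proj P -> T P.
Let hD := ax_half axD.
Let hD' := ax_half_op axD.

(** The predicate [T] is the class of test objects, level modules or absolutely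
    clean modules.  The cycles of a complete resolution form a closed class;
    only the coresolution needs to be recorded, since any projective resolution
    serves as the other half once the Ext groups vanish. *)
Definition gac_closed (C : D -> Prop) := forall X, C X ->
  (forall L k, T L -> ext k X L) /\ exists P X', [/\ proj P, ses X P X' & C X'].

Definition gac (M : D) := exists C, gac_closed C /\ C M.

Lemma gac_ext M : gac M -> forall L k, T L -> ext k M L.
Proof. by move=> [C [cC /cC[]]]. Qed.

Lemma gac_step M : gac M -> exists P X', [/\ proj P, ses M P X' & gac X'].
Proof.
move=> [C [cC /cC[_ [P [X' [pP MPX CX]]]]]].
by exists P, X'; split=> //; exists C.
Qed.

Lemma gac_proj P : proj P -> gac P.
Proof.
move=> pP; exists (@proj D); split=> // {pP}P pP.
split=> [L k _|]; first exact: ext_proj.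
have [S PSP] := ses_sum hD P P.
by exists S, P; split=> //; apply: (proj_mid axD PSP).
Qed.

(** The objects with a filtration A, C by objects of [gac] form a closed class:
    the horseshoe lemma applies since Ext^1(C, P) = 0 for projective P, which is
    a test object. *)
Lemma gac_mid A B C : ses A B C -> gac A -> gac C -> gac B.
Proof.
move=> ABC gA gC.
exists (fun X => exists A C, [/\ gac A, gac C & ses A X C]); split; last first.
  by exists A, C.
move=> {gA gC ABC}X [{}A [{}C [gA gC AXC]]]; split=> [L k TL|].
  by apply: (ext_mid axD AXC); apply: gac_ext.
have [P [A' [pP APA gA']]] := gac_step gA.
have [Q [C' [pQ CQC gC']]] := gac_step gC.
have oCP : orth C P by apply: (gac_ext gC 0); apply: projT.
have [S [B' [PSQ XSB ABC']]] := horseshoe axD AXC APA CQC oCP.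
exists S, B'; split=> //; first exact: proj_mid PSQ _ _.
by exists A', C'.
Qed.

Fixpoint gdim n (M : D) : Prop :=
  if n is m.+1 then exists K G, [/\ gac G, ses K G M & gdim m K] else gac M.

Lemma gdim_ext n M L : gdim n M -> T L -> ext n M L.
Proof.
move=> dM TL; suff: forall k, ext (k + n) M L by move=> /(_ 0).
elim: n M dM => [|n IHn] M /= => [gM k|]; first exact: gac_ext.
move=> [K [G [gG KGM dK]]] k; rewrite addnS.
apply/(ext_shift axD (k + n) KGM); last exact: IHn.
by move=> j; apply: gac_ext.
Qed.

(** Given a presentation of M by G0 with kernel K, and H containing K by
    induction, the pushout E of G0 and H is an extension of objects of [gac], so
    it embeds in a projective P with cokernel in [gac].  Dividing by H embeds M,
    which is E modulo H, into P modulo H. *)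
Lemma gdim_approx n M : gdim n M ->
  exists H G, [/\ ses M H G, gac G & forall Y, ext n H Y].
Proof.
elim: n M => [|n IHn] M /=.
  by case/gac_step=> P [X [pP MPX gX]]; exists P, X.
move=> [K [G0 [gG0 KGM /IHn[H [G [KHG gG eH]]]]]].
have [E [GEG HEM]] := ses_pushout hD KGM KHG.
have [P [G' [pP EPG gG']]] := gac_step (gac_mid GEG gG0 gG).
have [Q [HPQ MQG]] := ses_quotient hD HEM EPG.
by exists Q, G'; split=> // Y; apply/(ext_shift_proj axD _ _ pP HPQ).
Qed.

Fixpoint tres n (A : D) : Prop :=
  if n is m.+1 then exists K P, [/\ T P, ses K P A & tres m K] else T A.

(** Dimension shifting in the second variable, which is [ext_shift] in the
    opposite structure. *)
Lemma tres_orth n A G k : tres n A -> gac G -> ext k G A.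
Proof.
move=> tA gG; elim: n k A tA => [|n IHn] k A /=; first exact: gac_ext.
move=> [K [P [TP KPA /(IHn k.+1)/(ext_op axD) eK]]].
apply/(ext_op axD); apply/(ext_shift (axioms_op axD) k KPA) => // j.
exact/(ext_op axD)/gac_ext.
Qed.

(** The approximation of A splits, so A inherits the bound on the projective
    dimension of H. *)
Lemma gdim_tres_ext n m A : gdim n A -> tres m A -> forall Y, ext n A Y.
Proof.
move=> /gdim_approx[H [G [AHG gG eH]]] tA Y.
exact: (ext_retract axD AHG (@tres_orth m A G 0 tA gG)).
Qed.

(** The n-th syzygies of all objects form a closed class.  Their Ext groups
    against test objects are Ext groups in degree above n; and embedding M into
    an injective I with cokernel M' embeds the syzygy of M into a syzygy of I,
    projective by hypothesis, with a syzygy of M' as cokernel. *)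
Lemma gdim_all n : (forall L, T L -> forall Y : D, ext n Y L) ->
  (forall I : D, inj I -> forall Y, ext n I Y) -> forall M, gdim n M.
Proof.
move=> idT pdI M.
have [Z sMZ] := syz_ex axD n M.
have gZ : gac Z.
  exists (fun X => exists M, syz n M X); split; last by exists M.
  move=> X [{sMZ}M sMX]; split=> [L k TL|].
    by apply/(syz_ext axD _ _ sMX)/(extS_all axD (idT _ TL))/leq_addl.
  have [M' [I [iI MIM]]] := enough_proj hD' M.
  have [J [X' [sIJ sMX' XJX]]] := syz_ses axD MIM sMX.
  exists J, X'; split=> //; last by exists M'.
  by move=> Y; apply/(syz_ext axD 0 _ sIJ); apply: pdI.
elim: n M sMZ {idT pdI} => [|n IHn] M /= => [->//|].
move=> [K [P [pP KPM /IHn dK]]]; exists K, P; split=> //.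
exact: gac_proj.
Qed.

(** One direction takes the class of all cycles.  In the other, the cycles of
    negative index are chosen by iterating the coresolution, those of positive
    index by iterating syzygies. *)
Lemma gacZ (M : D) : gac M <-> exists Z : int -> D, Z 0%R = M /\
  forall i, (exists2 P, proj P & ses (Z (i + 1)%R) P (Z i)) /\
            (forall L, T L -> orth (Z i) L).
Proof.
split=> [gM|[Z [<- ZP]]]; last first.
  exists (fun X => exists i, X = Z i); split; last by exists 0%R.
  move=> _ [i ->]; split=> [L k TL|].
    elim: k i => [|k IHk] i; first by have [_] := ZP i; apply.
    have [[P pP ZPZ] _] := ZP i.
    by apply/(ext_shift_proj axD _ _ pP ZPZ).
  have [[P pP ZPZ] _] := ZP (i - 1)%R; rewrite subrK in ZPZ.
  by exists P, (Z (i - 1)%R); split=> //; exists (i - 1)%R.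
have [s sP] : {s & forall X : D, exists2 P, proj P & ses (s X) P X}.
  apply: (choice (P := fun X K : D => exists2 P, proj P & ses K P X)) => X.
  have [K [P [pP KPX]]] := enough_proj hD X.
  by exists K, P.
have [c cP] : {c & forall X, gac X ->
    (exists2 P, proj P & ses X P (c X)) /\ gac (c X)}.
  apply: (choice (P := fun X X' : D => gac X ->
    (exists2 P, proj P & ses X P X') /\ gac X')) => X.
  have [gX|ngX] := pselect (gac X); last by exists X.
  by have [P [X' [pP XPX gX']]] := gac_step gX; exists X'; split=> //; exists P.
have gc k : gac (iter k c M) by elim: k => //= k /cP[].
exists (fun i => match i with Posz k => iter k s M | Negz k => iter k.+1 c M end).
split=> // -[k|k]; split.
- have -> : (Posz k + 1 = Posz k.+1)%R by rewrite -PoszD addn1.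
  exact: sP.
- move=> L TL; rewrite -/(ext 0 (iter k s M) L).
  elim: k 0 => [|k IHk] j /=; first exact: gac_ext.
  have [P pP sPM] := sP (iter k s M).
  by apply/(ext_shift_proj axD _ _ pP sPM).
- have [+ _] := cP _ (gc k); case: k => [|k] //.
  have -> // : (Negz k.+1 + 1 = Negz k)%R.
  by rewrite !NegzE -[k.+2]addn1 PoszD opprD subrK.
- by move=> L TL; apply: (gac_ext (gc k.+1) 0).
Qed.
End GAC.

(** * Short exact sequences of modules *)

Local Open Scope ring_scope.
Local Open Scope quotient_scope.

Definition mk_linear (R : pzRingType) (U V : lmodType R) (f : U -> V)
    (lf : linear f) : {linear U -> V} :=
  HB.pack f (GRing.isLinear.Build R U V *:%R f lf).

Section Quot.
Variables (R : pzRingType) (A B : lmodType R) (f : {linear A -> B}).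

Definition image_pred : {pred B} := fun y => `[< exists x, f x = y >].

Lemma image_pred_zmod_closed : zmod_closed image_pred.
Proof.
split=> [|_ _ /asboolP[x <-] /asboolP[y <-]]; apply/asboolP.
  by exists 0; rewrite linear0.
by exists (x - y); rewrite linearB.
Qed.

HB.instance Definition _ := GRing.isZmodClosed.Build _ image_pred image_pred_zmod_closed.

Definition coker_mod := Quotient.quot image_pred.
HB.instance Definition _ := GRing.Zmodule.on coker_mod.

Definition coker_pi (x : B) : coker_mod := \pi x.

Lemma coker_piE x y : coker_pi x = coker_pi y <-> exists a, f a = x - y.
Proof.
have e : (coker_pi x == coker_pi y) = (x - y \in image_pred).
  by rewrite Quotient.idealrBE.
by split=> [/eqP|/asboolP h]; [rewrite e => /asboolP|apply/eqP; rewrite e].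
Qed.

Lemma coker_pi_is_zmod_morphism : zmod_morphism coker_pi.
Proof. exact: pi_is_zmod_morphism. Qed.

HB.instance Definition _ :=
  GRing.isZmodMorphism.Build B coker_mod coker_pi coker_pi_is_zmod_morphism.

Definition coker_scale (r : R) (q : coker_mod) : coker_mod :=
  coker_pi (r *: repr q).

Lemma coker_scale_pi r x : coker_scale r (coker_pi x) = coker_pi (r *: x).
Proof.
apply/coker_piE.
have [|a fa] := (coker_piE (repr (coker_pi x)) x).1; first exact: reprK.
by exists (r *: a); rewrite linearZ /= fa scalerBr.
Qed.

Lemma coker_pi_surj : surj coker_pi.
Proof. by move=> q; exists (repr q); apply: reprK. Qed.

Program Definition coker_lmod := GRing.Zmodule_isLmodule.Build R coker_mod
  (scale := coker_scale) _ _ _ _.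
Next Obligation.
by have [x <-] := coker_pi_surj v; rewrite !coker_scale_pi scalerA.
Qed.
Next Obligation.
by move=> v; have [x <-] := coker_pi_surj v; rewrite coker_scale_pi scale1r.
Qed.
Next Obligation.
move=> r v w; have [x <-] := coker_pi_surj v; have [y <-] := coker_pi_surj w.
by rewrite -raddfD !coker_scale_pi scalerDr raddfD.
Qed.
Next Obligation.
move=> r s; have [x <-] := coker_pi_surj v.
by rewrite !coker_scale_pi scalerDl raddfD.
Qed.
HB.instance Definition _ := coker_lmod.

Lemma coker_pi_linear : linear coker_pi.
Proof. by move=> r x y; rewrite raddfD; congr (_ + _); apply/esym/coker_scale_pi. Qed.

End Quot.

Section Sub.
Variables (R : pzRingType) (V : lmodType R) (P : V -> Prop).
Hypotheses (P0 : P 0) (PB : forall a x y, P x -> P y -> P (a *: x + y)).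
Definition sub_pred : {pred V} := fun y => `[< P y >].
Lemma sub_pred_closed : submod_closed sub_pred.
Proof.
by split=> [|a x y /asboolP ? /asboolP ?]; apply/asboolP => //; apply: PB.
Qed.
HB.instance Definition _ := GRing.isSubmodClosed.Build R V sub_pred sub_pred_closed.
Definition sub_mod := {x : V | sub_pred x}.
HB.instance Definition _ := SubChoice.on sub_mod.
HB.instance Definition _ := [SubChoice_isSubLmodule of sub_mod by <:].
Lemma sub_ex : 
  exists (A : lmodType R) (i : {linear A -> V}),
    injective i /\ forall x, P x <-> exists a, i a = x.
Proof.
exists (sub_mod : lmodType R), (val : {linear sub_mod -> V}).
split=> [|x]; first exact: val_inj.
split=> [Px|[[a Pa] <-]]; last exact/asboolP.
by exists (exist _ x (asboolT Px)).
Qed.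
End Sub.

Section Maps.
Variable R : pzRingType.
Implicit Types A B C U V W X Y Z E : lmodType R.

Lemma coker_ex A B (f : {linear A -> B}) :
  exists C (p : {linear B -> C}), surj p /\ exact_at f p.
Proof.
exists (coker_mod f), (mk_linear (@coker_pi_linear _ _ _ f)); split.
  exact: coker_pi_surj.
move=> y /=; rewrite -[0 in X in X <-> _](raddf0 (@coker_pi _ _ _ f)).
by rewrite coker_piE subr0.
Qed.

(** A right inverse of p as a function is enough: h does not see the choice. *)
Lemma epi_factor B C X (p : {linear B -> C}) (h : {linear B -> X}) : surj p ->
  (forall b, p b = 0 -> h b = 0) ->
  exists k : {linear C -> X}, forall b, k (p b) = h b.
Proof.
move=> sp ph; have [s sP] := choice sp.
have kp b : h (s (p b)) = h b.
  by apply/eqP; rewrite -subr_eq0 -linearB ph // linearB sP subrr.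
have lk : linear (h \o s).
  move=> a x y /=; rewrite -{1}(sP x) -{1}(sP y) -linearP kp linearP //.
by exists (mk_linear lk).
Qed.

Lemma mono_factor A B X (f : {linear A -> B}) (h : {linear X -> B}) :
  injective f -> (forall x, exists a, f a = h x) ->
  exists k : {linear X -> A}, forall x, f (k x) = h x.
Proof.
move=> fi /choice[k kP].
have lk : linear k by move=> a x y; apply: fi; rewrite linearP !kP linearP.
by exists (mk_linear lk).
Qed.

Lemma ker_ex B C (p : {linear B -> C}) :
  exists A (f : {linear A -> B}), injective f /\ exact_at f p.
Proof.
have [||A [f [fi fP]]] := @sub_ex R B (fun y => p y = 0); first exact: linear0.
  by move=> a x y px py; rewrite linearP px py scaler0 addr0.
by exists A, f; split.
Qed.

Definition mses A B C (f : {linear A -> B}) (g : {linear B -> C}) :=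
  [/\ injective f, exact_at f g & surj g].

Lemma mses0 A B C (f : {linear A -> B}) (g : {linear B -> C}) a :
  mses f g -> g (f a) = 0.
Proof. by move=> [_ fg _]; apply/fg; exists a. Qed.

Lemma inj0 A B (f : {linear A -> B}) : (forall x, f x = 0 -> x = 0) -> injective f.
Proof. exact: raddf_inj. Qed.

(** E is the quotient of the sum of V and Y by the pairs (f u, - h u). *)
Definition is_pushout U V Y E (f : {linear U -> V}) (h : {linear U -> Y})
    (j : {linear V -> E}) (i : {linear Y -> E}) :=
  [/\ forall u, j (f u) = i (h u), forall e, exists v y, e = j v + i y &
    forall v y, j v + i y = 0 -> exists u, v = f u /\ y = - h u].

Lemma pushout_sym U V Y E (f : {linear U -> V}) (h : {linear U -> Y})
    (j : {linear V -> E}) (i : {linear Y -> E}) :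
  is_pushout f h j i -> is_pushout h f i j.
Proof.
move=> [c s k]; split=> [u|e|y v].
- by rewrite c.
- by have [v [y ->]] := s e; exists y, v; rewrite addrC.
- by rewrite addrC => /k[u [-> ->]]; exists (- u); rewrite !linearN opprK.
Qed.

Lemma pushout_ex U V Y (f : {linear U -> V}) (h : {linear U -> Y}) :
  exists E j i, @is_pushout U V Y E f h j i.
Proof.
have lfh : linear (fun u => (f u, - h u) : (V * Y)%type).
  by move=> a u v; congr (_, _); rewrite /= linearP // opprD scalerN.
have [E [p [sp pP]]] := coker_ex (mk_linear lfh).
have lj : linear (fun v => p (v, 0)).
  by move=> a u v; rewrite -linearP; congr (p (_, _)); rewrite /= scaler0 addr0.
have li : linear (fun y => p (0, y)).
  by move=> a u v; rewrite -linearP; congr (p (_, _)); rewrite /= scaler0 addr0.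
have pE v y : p (v, 0) + p (0, y) = p (v, y).
  by rewrite -linearD; congr (p (_, _)); rewrite /= ?addr0 ?add0r.
exists E, (mk_linear lj), (mk_linear li); split=> [u|e|v y] /=.
- apply/eqP; rewrite -subr_eq0 -linearB; apply/eqP/pP; exists u => /=.
  by congr (_, _); rewrite /= ?subr0 ?sub0r.
- by have [[v y] <-] := sp e; exists v, y; rewrite pE.
- by rewrite pE => /pP[u [<- <-]]; exists u.
Qed.

Lemma pushout_ses U V Y E X (f : {linear U -> V}) (h : {linear U -> Y})
    (j : {linear V -> E}) (i : {linear Y -> E}) (g : {linear V -> X}) :
  is_pushout f h j i -> mses f g ->
  exists q : {linear E -> X}, mses i q /\ forall v, q (j v) = g v.
Proof.
move=> [c s k] fg; have [fi ex sg] := fg.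
have ji : linear (fun vy : V * Y => j vy.1 + i vy.2).
  by move=> a [v y] [v' y'] /=; rewrite !linearP scalerDr addrACA.
have [||q qP] := @epi_factor _ _ _ (mk_linear ji) (g \o fst).
- by move=> e; have [v [y ->]] := s e; exists (v, y).
- by move=> [v y] /= /k[u [-> _]]; apply: mses0 fg.
have qj v : q (j v) = g v by have /= := qP (v, 0); rewrite linear0 addr0.
have qi y : q (i y) = 0 by have /= := qP (0, y); rewrite !linear0 add0r.
exists q; split=> //; split=> [|e|x].
- apply: inj0 => y iy; have [|u [/esym fu ->]] := k 0 y.
    by rewrite linear0 add0r.
  by rewrite (fi u 0) ?linear0 ?oppr0.
- have [v [y ->]] := s e; rewrite linearD qi addr0 qj.
  split=> [/ex[u <-]|[y' ji']]; first by exists (h u + y); rewrite linearD c.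
  by rewrite -qj -(addrK (i y) (j v)) -ji' linearB !qi subr0.
- by have [v <-] := sg x; exists (j v).
Qed.

(** E is the submodule of pairs (v, x) with g v = h x. *)
Definition is_pullback E V X W (a : {linear E -> V}) (b : {linear E -> X})
    (g : {linear V -> W}) (h : {linear X -> W}) :=
  [/\ forall e, g (a e) = h (b e),
    forall v x, g v = h x -> exists e, a e = v /\ b e = x &
    forall e, a e = 0 -> b e = 0 -> e = 0].

Lemma pullback_sym E V X W (a : {linear E -> V}) (b : {linear E -> X})
    (g : {linear V -> W}) (h : {linear X -> W}) :
  is_pullback a b g h -> is_pullback b a h g.
Proof.
move=> [c s k]; split=> [e|x v /esym/s[e [? ?]]|e be ae]; first by rewrite c.
  by exists e.
exact: k.
Qed.

Lemma pullback_ex V X W (g : {linear V -> W}) (h : {linear X -> W}) :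
  exists E a b, @is_pullback E V X W a b g h.
Proof.
have l : linear (fun vx : V * X => g vx.1 - h vx.2).
  move=> a [v y] [v' y'] /=.
  by rewrite (linearP g) (linearP h) scalerBr opprD addrACA.
have [E [f [fi fP]]] := ker_ex (mk_linear l).
exists E, (fst \o f), (snd \o f); split=> [e|v x gh|e /= fe1 fe2].
- by apply/eqP; rewrite -subr_eq0; apply/eqP/fP; exists e.
- have /fP[e fe] : mk_linear l (v, x) = 0 by rewrite /= gh subrr.
  by exists e; rewrite /= fe.
- by apply: fi; rewrite linear0 [f e]surjective_pairing fe1 fe2.
Qed.

Lemma pullback_ses E V X W Y (a : {linear E -> V}) (b : {linear E -> X})
    (g : {linear V -> W}) (h : {linear X -> W}) (f : {linear Y -> V}) :
  is_pullback a b g h -> mses f g ->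
  exists i : {linear Y -> E}, mses i b /\ forall y, a (i y) = f y.
Proof.
move=> [c s k] fg; have [fi ex sg] := fg.
have lab : linear (fun e => (a e, b e)) by move=> r x y; rewrite !linearP.
have lf0 : linear (fun y => (f y, 0 : X)).
  by move=> r x y; rewrite linearP; congr (_, _); rewrite /= scaler0 addr0.
have [||i iP] := @mono_factor _ _ _ (mk_linear lab) (mk_linear lf0).
- by apply: inj0 => e [/k]; apply.
- move=> y; have [|e [ae be]] := s (f y) 0; first by rewrite linear0 (mses0 _ fg).
  by exists e; rewrite /= ae be.
have [ai bi] : (forall y, a (i y) = f y) /\ (forall y, b (i y) = 0).
  by split=> y; case: (iP y).
exists i; split=> //; split=> [|e|x].
- by apply: inj0 => y iy; apply: fi; rewrite -ai iy !linear0.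
- split=> [be|[y <-] //]; have [|y fy] := (ex (a e)).1.
    by rewrite c be linear0.
  exists y; apply/eqP; rewrite -subr_eq0; apply/eqP/k; rewrite linearB.
    by rewrite ai fy subrr.
  by rewrite bi be subrr.
- by have [v gv] := sg (h x); have [e [_ <-]] := s v x gv; exists e.
Qed.

Lemma section_of_retraction A B C (f : {linear A -> B}) (g : {linear B -> C})
    (r : {linear B -> A}) : mses f g -> (forall a, r (f a) = a) ->
  exists s : {linear C -> B}, forall c, g (s c) = c.
Proof.
move=> fg rf; have [fi ex sg] := fg.
have l : linear (fun b => b - f (r b)).
  by move=> a x y; rewrite (linearP r) (linearP f) scalerBr opprD addrACA.
have [|b /ex[a <-]|s sP] := @epi_factor _ _ _ g (mk_linear l) => //.
  by rewrite /= rf subrr.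
exists s => c; have [b <-] := sg c.
by rewrite sP /= linearB (mses0 _ fg) subr0.
Qed.

Lemma retraction_of_section A B C (f : {linear A -> B}) (g : {linear B -> C})
    (s : {linear C -> B}) : mses f g -> (forall c, g (s c) = c) ->
  exists r : {linear B -> A}, forall a, r (f a) = a.
Proof.
move=> fg gs; have [fi ex sg] := fg.
have l : linear (fun b => b - s (g b)).
  by move=> a x y; rewrite (linearP g) (linearP s) scalerBr opprD addrACA.
have [|b|r rP] := @mono_factor _ _ _ f (mk_linear l) => //.
  by apply/ex; rewrite /= linearB gs subrr.
by exists r => a; apply: fi; rewrite rP /= (mses0 _ fg) linear0 subr0.
Qed.

Definition mod_ses A B C : Prop :=
  exists (f : {linear A -> B}) (g : {linear B -> C}), mses f g.

(** Ext^1(X, Y) = 0 in the sense of Yoneda. *)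
Definition mod_orth X Y : Prop :=
  forall E (f : {linear Y -> E}) (g : {linear E -> X}), mses f g ->
    exists r : {linear E -> Y}, forall y, r (f y) = y.

Lemma mod_orth_section X Y E (f : {linear Y -> E}) (g : {linear E -> X}) :
  mod_orth X Y -> mses f g -> exists s : {linear X -> E}, forall x, g (s x) = x.
Proof.
by move=> o fg; have [r rP] := o _ _ _ fg; apply: section_of_retraction fg rP.
Qed.

(** The pushout along h is an extension of X by Y; a retraction of it extends
    h. *)
Lemma mod_orth_extend X Y U V (f : {linear U -> V}) (g : {linear V -> X})
    (h : {linear U -> Y}) :
  mod_orth X Y -> mses f g -> exists k : {linear V -> Y}, forall u, k (f u) = h u.
Proof.
move=> o fg; have [E [j [i po]]] := pushout_ex f h.
have [q [iq _]] := pushout_ses po fg; have [r rP] := o _ _ _ iq.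
by exists (r \o j) => u /=; have [-> _ _] := po; rewrite rP.
Qed.

(** The pullback along h is an extension of X by Y; a section of it lifts h. *)
Lemma mod_orth_lift X Y V W (f : {linear Y -> V}) (g : {linear V -> W})
    (h : {linear X -> W}) :
  mod_orth X Y -> mses f g -> exists k : {linear X -> V}, forall x, g (k x) = h x.
Proof.
move=> o fg; have [E [a [b pb]]] := pullback_ex g h.
have [i [ib _]] := pullback_ses pb fg; have [s sP] := mod_orth_section o ib.
by exists (a \o s) => x /=; have [-> _ _] := pb; rewrite sP.
Qed.

(** The sequence Hom(V, Y), Hom(U, Y), Ext^1(X, Y), Ext^1(V, Y): lift g to an
    extension E of X by Y, correct the lift on V so that it kills U, and obtain
    a section of E. *)
Lemma mod_orth_of_extend X Y U V (f : {linear U -> V}) (g : {linear V -> X}) :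
  mses f g -> mod_orth V Y ->
  (forall h : {linear U -> Y}, exists k : {linear V -> Y}, forall u, k (f u) = h u) ->
  mod_orth X Y.
Proof.
move=> fg o ext E i q iq; have [l lP] := mod_orth_lift g o iq.
have [ii ex sq] := iq; have [fi exf sg] := fg.
have [//|u|h hP] := @mono_factor _ _ _ i (l \o f).
  by apply/ex; rewrite /= lP (mses0 _ fg).
have [k kP] := ext h.
have lm : linear (fun v => l v - i (k v)).
  by move=> a x y; rewrite (linearP l) (linearP k) (linearP i) scalerBr opprD addrACA.
have [//|_ /exf[u <-]|s sP] := @epi_factor _ _ _ g (mk_linear lm).
  by rewrite /= kP hP subrr.
apply: (retraction_of_section (s := s) iq) => x; have [v <-] := sg x.
by rewrite sP /= linearB lP (mses0 _ iq) subr0.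
Qed.

(** The sequence Hom(X, V), Hom(X, W), Ext^1(X, Y), Ext^1(X, V), dually. *)
Lemma mod_orth_of_lift X Y V W (f : {linear Y -> V}) (g : {linear V -> W}) :
  mses f g -> mod_orth X V ->
  (forall h : {linear X -> W}, exists k : {linear X -> V}, forall x, g (k x) = h x) ->
  mod_orth X Y.
Proof.
move=> fg o lift E i q iq; have [l lP] := mod_orth_extend f o iq.
have [ii ex sq] := iq; have [fi exf sg] := fg.
have [//|_ /ex[y <-]|h hP] := @epi_factor _ _ _ q (g \o l).
  by rewrite /= lP (mses0 _ fg).
have [k kP] := lift h.
have lm : linear (fun e => l e - k (q e)).
  by move=> a x y; rewrite (linearP l) (linearP q) (linearP k) scalerBr opprD addrACA.
have [//|e|r rP] := @mono_factor _ _ _ f (mk_linear lm).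
  by apply/exf; rewrite /= linearB kP hP subrr.
exists r => y; apply: fi; rewrite rP /= lP (mses0 _ iq) linear0 subr0 //.
Qed.
End Maps.

Section ModAxioms.
Variable R : pzRingType.
Implicit Types A B C U V W X Y Z E : lmodType R.

Definition Mod : ext_data := ExtData (@mod_ses R) (@mod_orth R).

(** Lift A to the extension E of B by Y; then E modulo A is an extension of C by
    Y, and a retraction of it composes to one of E. *)
Lemma mod_orth_mid A B C Y :
  mod_ses A B C -> mod_orth A Y -> mod_orth C Y -> mod_orth B Y.
Proof.
move=> [f [g fg]] oA oC E i q iq.
have [l lP] := mod_orth_lift f oA iq.
have [fi exf sg] := fg; have [ii exi sq] := iq.
have [Q [p [sp ep]]] := coker_ex l.
have [//|_ /ep[a <-]|t tP] := @epi_factor _ _ _ _ p (g \o q).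
  by rewrite /= lP (mses0 _ fg).
have [|r rP] := oC _ (p \o i) t; last by exists (r \o p).
split=> [|z|c].
- apply: inj0 => y /ep[a la]; suff a0 : a = 0.
    by apply: ii; rewrite -la a0 !linear0.
  by apply: fi; rewrite -lP la (mses0 _ iq) linear0.
- split=> [|[y <-]]; last by rewrite tP /= (mses0 _ iq) linear0.
  have [e <-] := sp z; rewrite tP => /exf[a fa].
  have [|y iy] := (exi (e - l a)).1; first by rewrite linearB lP fa subrr.
  exists y; rewrite /= iy linearB; suff -> : p (l a) = 0 by rewrite subr0.
  by apply/ep; exists a.
- have [b <-] := sg c; have [e <-] := sq b; exists (p e); exact: tP.
Qed.

(** Extend B to C over the extension E of X by B; the kernel of E to C is an
    extension of X by A, and a section of it is one of E. *)
Lemma mod_orth_mid_op A B C X :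
  mod_ses A B C -> mod_orth X A -> mod_orth X C -> mod_orth X B.
Proof.
move=> [f [g fg]] oA oC E i q iq.
have [l lP] := mod_orth_extend g oC iq.
have [fi exf sg] := fg; have [ii exi sq] := iq.
have [K [k [ki ek]]] := ker_ex l.
have [//|a|t tP] := @mono_factor _ _ _ _ k (i \o f).
  by apply/ek; rewrite /= lP (mses0 _ fg).
suff [s sP] : exists s : {linear X -> K}, forall x, (q \o k) (s x) = x.
  exact: (retraction_of_section (s := k \o s) iq).
(* The maps t and q after k make K an extension of X by A. *)
apply: (mod_orth_section (f := t)) => //; split=> [|z|x].
- apply: inj0 => a ta; apply/fi/ii.
  by have /= := tP a; rewrite ta !linear0 => <-.
- split=> [/= /exi[b ib]|[a <-]]; last by rewrite /= tP /= (mses0 _ iq).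
  have [|a fa] := (exf b).1; first by rewrite -lP ib; apply/ek; exists z.
  by exists a; apply: ki; rewrite tP /= fa.
- have [e <-] := sq x; have [b gb] := sg (l e).
  have /ek[z kz] : l (e - i b) = 0 by rewrite linearB lP gb subrr.
  by exists z; rewrite /= kz linearB (mses0 _ iq) subr0.
Qed.

Lemma mod_orth_shift X' P X Y I Y' : mod_ses X' P X -> mod_ses Y I Y' ->
  mod_orth P Y' -> mod_orth X I -> mod_orth X' Y -> mod_orth X Y'.
Proof.
move=> [f [g fg]] [i [p ip]] oP oI oY; apply: (mod_orth_of_extend fg oP) => h.
have [k kP] := mod_orth_lift h oY ip; have [l lP] := mod_orth_extend k oI fg.
by exists (p \o l) => u /=; rewrite lP kP.
Qed.

Lemma mod_orth_shift_op X' P X Y I Y' : mod_ses X' P X -> mod_ses Y I Y' ->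
  mod_orth P Y -> mod_orth X' I -> mod_orth X Y' -> mod_orth X' Y.
Proof.
move=> [f [g fg]] [i [p ip]] oP oI oY; apply: (mod_orth_of_lift ip oI) => h.
have [k kP] := mod_orth_extend h oY fg; have [l lP] := mod_orth_lift k oP ip.
by exists (l \o f) => u /=; rewrite lP kP.
Qed.

Lemma mod_orth_retract A B C Y :
  mod_ses A B C -> mod_orth C A -> mod_orth B Y -> mod_orth A Y.
Proof.
move=> [f [g fg]] o oB E i q iq; have [r rP] := o _ _ _ fg.
have [k kP] := mod_orth_lift r oB iq.
by apply: (retraction_of_section (s := k \o f) iq) => a /=; rewrite kP rP.
Qed.

Lemma mod_orth_retract_op A B C X :
  mod_ses A B C -> mod_orth C A -> mod_orth X B -> mod_orth X C.
Proof.
move=> [f [g fg]] o oB E i q iq; have [s sP] := mod_orth_section o fg.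
have [k kP] := mod_orth_extend s oB iq.
by exists (g \o k) => c /=; rewrite kP sP.
Qed.

Lemma mod_pushout K G M H G' : mod_ses K G M -> mod_ses K H G' ->
  exists E, mod_ses G E G' /\ mod_ses H E M.
Proof.
move=> [a [b ab]] [c [d cd]]; have [E [j [i po]]] := pushout_ex a c.
have [q [iq _]] := pushout_ses po ab.
have [q' [jq _]] := pushout_ses (pushout_sym po) cd.
by exists E; split; [exists j, q'|exists i, q].
Qed.

Lemma mod_pullback K G M H G' : mod_ses M G K -> mod_ses G' H K ->
  exists E, mod_ses G' E G /\ mod_ses M E H.
Proof.
move=> [a [b ab]] [c [d cd]]; have [E [j [i pb]]] := pullback_ex b d.
have [q [iq _]] := pullback_ses pb ab.
have [q' [jq _]] := pullback_ses (pullback_sym pb) cd.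
by exists E; split; [exists q', j|exists q, i].
Qed.

Lemma mod_quotient H E M P G : mod_ses H E M -> mod_ses E P G ->
  exists Q, mod_ses H P Q /\ mod_ses M Q G.
Proof.
move=> [a [b ab]] [c [d cd]].
have [ai exa sb] := ab; have [ci exc sd] := cd.
have [Q [p [sp ep]]] := coker_ex (c \o a).
exists Q; split; first by exists (c \o a), p; split=> //; apply: inj_comp.
have [//|e /exa[h <-]|u uP] := @epi_factor _ _ _ _ b (p \o c).
  by apply/ep; exists h.
have [//|_ /ep[h <-]|v vP] := @epi_factor _ _ _ _ p d.
  exact: (mses0 _ cd).
exists u, v; split=> [|z|g].
- apply: inj0 => m; have [e <-] := sb m; rewrite uP => /ep[h /ci <-].
  exact: (mses0 _ ab).
- split=> [|[m <-]].
    by have [x <-] := sp z; rewrite vP => /exc[e <-]; exists (b e); apply: uP.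
  by have [e <-] := sb m; rewrite uP /= vP (mses0 _ cd).
- by have [x <-] := sd g; exists (p x).
Qed.

Lemma mod_subobject H E M P G : mod_ses M E H -> mod_ses G P E ->
  exists Q, mod_ses Q P H /\ mod_ses G Q M.
Proof.
move=> [a [b ab]] [c [d cd]].
have [ai exa sb] := ab; have [ci exc sd] := cd.
have [Q [k [ki ek]]] := ker_ex (b \o d).
exists Q; split.
  exists k, (b \o d); split=> // h; have [e <-] := sb h; have [x <-] := sd e.
  by exists x.
have [//|x|u uP] := @mono_factor _ _ _ _ a (d \o k).
  by apply/exa/ek; exists x.
have [//|g|v vP] := @mono_factor _ _ _ _ k c.
  by apply/ek; rewrite /= (mses0 _ cd) linear0.
exists v, u; split=> [|z|m].
- by apply: inj0 => g vg; apply: ci; rewrite -vP vg !linear0.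
- split=> [uz|[g <-]].
    have /exc[g cg] : d (k z) = 0 by have /= <- := uP z; rewrite uz linear0.
    by exists g; apply: ki; rewrite vP.
  by apply: ai; rewrite uP /= vP (mses0 _ cd) linear0.
- have [x dx] := sd (a m).
  have /ek[z kz] : (b \o d) x = 0 by rewrite /= dx (mses0 _ ab).
  by exists z; apply: ai; rewrite uP /= kz.
Qed.

Lemma pair_ex U V W (f : {linear U -> V}) (g : {linear U -> W}) :
  exists k : {linear U -> (V * W)%type}, forall u, k u = (f u, g u).
Proof.
have l : linear (fun u => (f u, g u)).
  by move=> a x y; congr (_, _); rewrite /= linearP.
by exists (mk_linear l).
Qed.

Lemma copair_ex U V W (f : {linear V -> U}) (g : {linear W -> U}) :
  exists k : {linear (V * W)%type -> U}, forall x, k x = f x.1 + g x.2.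
Proof.
have l : linear (fun x : (V * W)%type => f x.1 + g x.2).
  by move=> a [x y] [x' y'] /=; rewrite (linearP f) (linearP g) scalerDr addrACA.
by exists (mk_linear l).
Qed.

Lemma mod_sum A B : exists S, mod_ses A S B.
Proof.
have [i iP] := pair_ex (idfun : {linear A -> A}) (\0 : {linear A -> B}).
exists (A * B)%type, i, snd; split=> [x y|[x y]|y].
- by rewrite !iP => -[].
- by split=> [/= ->|[z]]; [exists x; rewrite iP|rewrite iP => -[_ <-]].
- by exists (0, y).
Qed.

Lemma mod_extend I E C J C' : mod_ses I E C -> mod_ses C J C' -> mod_orth C I ->
  exists S, mod_ses I S J /\ mod_ses E S C'.
Proof.
move=> [a [b ab]] [c [d cd]] o; have [r rP] := o _ _ _ ab.
have [ai exa sb] := ab; have [ci exc sd] := cd.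
exists (I * J)%type; split.
  have [i iP] := pair_ex (idfun : {linear I -> I}) (\0 : {linear I -> J}).
  exists i, snd; split=> [x y|[x y]|y].
  - by rewrite !iP => -[].
  - by split=> [/= ->|[z]]; [exists x; rewrite iP|rewrite iP => -[_ <-]].
  - by exists (0, y).
have [k kP] := pair_ex r (c \o b).
exists k, (d \o snd); split=> [|[i j]|z].
- apply: inj0 => e; rewrite kP => -[re]; rewrite -(linear0 c) => /ci/exa[x xe].
  by move: re; rewrite -xe rP => ->; rewrite linear0.
- split=> [/= /exc[x <-]|[e]].
    have [e <-] := sb x; exists (e + a (i - r e)).
    have bE : b (e + a (i - r e)) = b e by rewrite linearD (mses0 _ ab) addr0.
    by rewrite kP /= bE linearD rP addrC subrK.
  by rewrite kP => -[_ <-] /=; rewrite (mses0 _ cd).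
- by have [j <-] := sd z; exists (0, j).
Qed.

Lemma mod_coextend I E C J C' : mod_ses C E I -> mod_ses C' J C -> mod_orth I C ->
  exists S, mod_ses J S I /\ mod_ses C' S E.
Proof.
move=> [a [b ab]] [c [d cd]] o; have [s sP] := mod_orth_section o ab.
have [ai exa sb] := ab; have [ci exc sd] := cd.
exists (J * I)%type; split.
  have [i iP] := pair_ex (idfun : {linear J -> J}) (\0 : {linear J -> I}).
  exists i, snd; split=> [x y|[x y]|y].
  - by rewrite !iP => -[].
  - by split=> [/= ->|[z]]; [exists x; rewrite iP|rewrite iP => -[_ <-]].
  - by exists (0, y).
have [i iP] := pair_ex c (\0 : {linear C' -> I}).
have [k kP] := copair_ex (a \o d) s.
exists i, k; split=> [|[j x]|e].
- by move=> x y; rewrite !iP => -[/ci].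
- rewrite kP /=; split=> [ads|[z]].
    have x0 : x = 0.
      by have := congr1 b ads; rewrite linearD (mses0 _ ab) sP add0r linear0.
    move: ads; rewrite x0 linear0 addr0 -(linear0 a) => /ai/exc[z <-].
    by exists z; rewrite iP.
  by rewrite iP /= => -[<- <-]; rewrite (mses0 _ cd) !linear0 addr0.
- have /exa[x ax] : b (e - s (b e)) = 0 by rewrite linearB sP subrr.
  have [j dj] := sd x; exists (j, b e).
  by rewrite kP /= dj ax subrK.
Qed.
End ModAxioms.

(** * Free modules *)

Section Free.
Variable R : pzRingType.
Implicit Types A B C M N X Y P : lmodType R.

Lemma projectiveP P : projective P <-> forall Y, mod_orth P Y.
Proof.
split=> [pP Y E f g fg|oP M N g h sg].
  have [s sP] := pP _ _ g idfun (let: And3 _ _ sg := fg in sg).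
  exact: (retraction_of_section (s := s) fg).
have [A [f [fi ef]]] := ker_ex g.
by apply: (mod_orth_lift (f := f)); [apply: oP|split].
Qed.

Lemma injectiveP P : injective_module P <-> forall X, mod_orth X P.
Proof.
split=> [iP X E f g [fi _ _]|oP M N f h fi].
  by have [r rP] := iP _ _ f idfun fi; exists r.
have [A [g [sg eg]]] := coker_ex f.
by apply: (mod_orth_extend (g := g)); [apply: oP|split].
Qed.

Lemma sum_support (T : eqType) N (f : T -> R) (g : T -> N) (s s' : seq T) :
  uniq s -> uniq s' -> (forall x, x \notin s -> f x = 0) ->
  (forall x, x \notin s' -> f x = 0) ->
  \sum_(x <- s) f x *: g x = \sum_(x <- s') f x *: g x.
Proof.
have red r : \sum_(x <- r) f x *: g x =
    \sum_(x <- [seq y <- r | f y != 0]) f x *: g x.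
  rewrite big_filter; symmetry; apply: big_rmcond => x; rewrite negbK => /eqP ->.
  by rewrite scale0r.
move=> us us' fs fs'; rewrite (red s) (red s'); apply: perm_big; apply: uniq_perm.
- exact: filter_uniq.
- exact: filter_uniq.
move=> x; rewrite !mem_filter; case: eqP => //= fx.
have [|/fs //] := boolP (x \in s); have [|/fs' //] := boolP (x \in s') => //.
Qed.

(** Functions of finite support. *)
Lemma free_ex (T : eqType) : exists (F : lmodType R) (d : T -> F),
  (forall (N : lmodType R) (g : T -> N),
     exists h : {linear F -> N}, forall t, h (d t) = g t) /\
  (forall (N : lmodType R) (h h' : {linear F -> N}),
     (forall t, h (d t) = h' (d t)) -> h =1 h').
Proof.
pose fin (f : T -> R^o) := exists s : seq T, forall x, x \notin s -> f x = 0.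
have [||F [i [ii iP]]] := @sub_ex R (T -> R^o) fin.
- by exists [::].
- move=> a f g [s sP] [s' sP']; exists (s ++ s') => x.
  rewrite mem_cat negb_or => /andP[/sP fx /sP' gx].
  by rewrite -[LHS]/(a *: f x + g x) fx gx scaler0 addr0.
pose c a t : R := i a t.
have cP a u v t : c (a *: u + v) t = a * c u t + c v t by rewrite /c linearP.
have supp a : exists s : seq T, uniq s /\ forall x, x \notin s -> c a x = 0.
  have [s sP] := (iP (i a)).2 (ex_intro _ a erefl).
  by exists (undup s); rewrite undup_uniq; split=> // x; rewrite mem_undup; apply: sP.
have [s sP] := choice supp.
have dP t : exists a, i a = fun x => (x == t)%:R : R^o.
  by apply/iP; exists [:: t] => x; rewrite inE => /negbTE ->.
have [d dE] := choice dP.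
have {}dE t x : c (d t) x = (x == t)%:R by rewrite /c dE.
have sumE (N : lmodType R) (g : T -> N) a r : uniq r -> {subset s a <= r} ->
    \sum_(x <- s a) c a x *: g x = \sum_(x <- r) c a x *: g x.
  move=> ur sr; have [us zs] := sP a; apply: sum_support => // x xr; apply: zs.
  by apply: contra xr; apply: sr.
have lin (N : lmodType R) (g : T -> N) : linear (fun a => \sum_(x <- s a) c a x *: g x).
  move=> a u v; pose r := undup (s (a *: u + v) ++ s u ++ s v).
  have ur : uniq r by apply: undup_uniq.
  rewrite !(sumE _ _ _ r) //; last first.
  - by move=> x xs; rewrite mem_undup !mem_cat xs.
  - by move=> x xs; rewrite mem_undup !mem_cat xs !orbT.
  - by move=> x xs; rewrite mem_undup !mem_cat xs !orbT.
  rewrite scaler_sumr -big_split; apply: eq_bigr => x _ /=.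
  by rewrite cP scalerDl scalerA.
have sum1 (N : lmodType R) (g : T -> N) t r : uniq r -> t \in r ->
    \sum_(x <- r) c (d t) x *: g x = g t.
  move=> ur tr; rewrite (big_rem t) //= big_seq big1 ?addr0 => [|x].
    by rewrite dE eqxx scale1r.
  rewrite mem_rem_uniq // inE => /andP[/negbTE xt _].
  by rewrite dE xt scale0r.
have csum r (a : T -> R) t : c (\sum_(x <- r) a x *: d x) t =
    \sum_(x <- r) a x * (t == x)%:R.
  elim: r => [|x r IHr]; first by rewrite !big_nil /c linear0.
  by rewrite !big_cons cP IHr dE.
have basis a : a = \sum_(x <- s a) c a x *: d x.
  apply: ii; apply/funext => t; rewrite -[LHS]/(c a t) -[RHS]/(c _ t) csum.
  have [us zs] := sP a.
  have [ts|ts] := boolP (t \in s a); last first.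
    rewrite zs // big_seq big1 // => x xs.
    by case: eqP => [tx|_]; rewrite ?mulr0 // tx xs in ts *.
  rewrite (big_rem t) //= big_seq big1 ?addr0 => [|x]; first by rewrite eqxx mulr1.
  by rewrite mem_rem_uniq // inE eq_sym => /andP[/negbTE -> _]; rewrite mulr0.
exists F, d; split=> [N g|N h h' hh' a].
  exists (mk_linear (lin N g)) => t /=.
  rewrite (sumE _ _ _ (undup (t :: s (d t)))) ?undup_uniq //; last first.
    by move=> x xs; rewrite mem_undup inE xs orbT.
  by rewrite sum1 ?undup_uniq ?mem_undup ?mem_head.
rewrite (basis a) !linear_sum; apply: eq_bigr => x _; rewrite !linearZ /= hh' //.
Qed.

Lemma mod_enough_proj X : exists K P, (forall Y, mod_orth P Y) /\ mod_ses K P X.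
Proof.
have [F [d [ex un]]] := free_ex X.
have [p pP] := ex X id; have [K [k [ki ek]]] := ker_ex p.
exists K, F; split; last by exists k, p; split=> // x; exists (d x).
apply/projectiveP => M N g h sg; have [m mP] := choice (fun t => sg (h (d t))).
have [l lP] := ex M m; exists l; apply: (un _ (g \o l) h) => t /=.
by rewrite lP mP.
Qed.
End Free.

(** * Characters with values in Q/Z *)

Definition int_rat : {pred rat} := fun x => x \is a Num.int.

Lemma int_rat_zmod_closed : zmod_closed int_rat.
Proof. by split=> [|x y]; [apply: rpred0|apply: rpredB]. Qed.
HB.instance Definition _ :=
  GRing.isZmodClosed.Build _ int_rat int_rat_zmod_closed.

Definition QZ := Quotient.quot int_rat.
HB.instance Definition _ := GRing.Zmodule.on QZ.

Definition QZpi (x : rat) : QZ := \pi x.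
Lemma QZpi_is_zmod_morphism : zmod_morphism QZpi.
Proof. exact: pi_is_zmod_morphism. Qed.
HB.instance Definition _ :=
  GRing.isZmodMorphism.Build rat QZ QZpi QZpi_is_zmod_morphism.

Lemma QZpi_eq0 x : (QZpi x == 0) = (x \is a Num.int).
Proof.
have := Quotient.idealrBE int_rat x 0; rewrite subr0 => ->.
by rewrite -(raddf0 QZpi).
Qed.

Lemma QZ_div (d : QZ) (m : nat) : (0 < m)%N -> exists e, e *~ m = d.
Proof.
move=> m0; exists (QZpi (repr d / m%:R)).
rewrite -pmulrn -raddfMn -[_ *+ m]mulr_natr divfK ?pnatr_eq0 -?lt0n //.
exact: reprK.
Qed.

Lemma QZ_tors (m : nat) : m != 1%N -> exists2 d : QZ, d != 0 & d *~ m = 0.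
Proof.
(* For m = 0 any nonzero element will do; 1/2 is one. *)
case: m => [_|[//|m _]].
  exists (QZpi (2%:R^-1)) => //; rewrite QZpi_eq0; apply/negP.
  by vm_compute.
exists (QZpi (m.+2%:R^-1)).
  rewrite QZpi_eq0; apply/negP => /intrP[z].
  have m2 : (m.+2%:R : rat) != 0 by rewrite pnatr_eq0.
  move/(congr1 ( *%R m.+2%:R)); rewrite mulfV // => /esym /eqP.
  rewrite -[m.+2%:R]/(m.+2%:~R) -intrM -[1]/(1%:~R) eqr_int => /eqP h.
  have := congr1 absz h; rewrite abszM /= => /eqP.
  by rewrite muln_eq1.
rewrite -pmulrn -raddfMn -[_ *+ m.+2]mulr_natr mulVf ?pnatr_eq0 //.
by apply/eqP; rewrite QZpi_eq0.
Qed.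

(** The generator is 0 exactly for the trivial subgroup, which lets later
    arguments treat elements of finite and infinite order alike. *)
Lemma int_subgroup (P : int -> Prop) : P 0 -> (forall m n, P m -> P n -> P (m - n)) ->
  exists m : nat, P m /\ forall n, P n -> exists q, n = q * m%:Z.
Proof.
move=> P0 PB.
have PN n : P n -> P (- n) by move=> Pn; rewrite -sub0r; apply: PB.
have PM q m : P m -> P (q * m).
  move=> Pm; have PMn k : P (k%:Z * m).
    elim: k => [|k IHk]; first by rewrite mul0r.
    by rewrite -addn1 PoszD mulrDl mul1r -[X in _ + X]opprK; apply: PB => //; apply: PN.
  by case: (intP q) => [|k|k]; rewrite ?mul0r ?mulNr //; apply: PN.
have [[m0 m0P]|none] := pselect (exists m : nat, `[< (0 < m)%N /\ P m >]); last first.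
  exists 0%N; split=> // n Pn; exists 0; rewrite mul0r.
  case: (intP n) Pn => // k Pk; case: none; exists k.+1; apply/asboolP; split=> //.
  by rewrite -[_%:Z]opprK; apply: PN.
have exP : exists m : nat, `[< (0 < m)%N /\ P m >] by exists m0.
case: (ex_minnP exP) => m /asboolP[m_gt0 Pm] mmin; exists m; split=> // n Pn.
exists (n %/ m)%Z; rewrite [LHS](divz_eq n m).
have mz : (m%:Z != 0) by rewrite eqz_nat -lt0n.
have Pr : P (n %% m)%Z.
  have -> : (n %% m)%Z = n - (n %/ m)%Z * m.
    by apply/eqP; rewrite eq_sym subr_eq addrC -divz_eq.
  by apply: PB => //; apply: PM.
have r0 := modz_ge0 n mz; have rm := ltz_pmod n (m_gt0 : (0 < m%:Z)).
case: (n %% m)%Z Pr r0 rm => // [[|k]] Pr _; first by rewrite addr0.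
rewrite ltz_nat => km; suff : (m <= k.+1)%N by rewrite leqNgt km.
by apply: mmin; apply/asboolP.
Qed.

Definition mk_additive (U V : zmodType) (f : U -> V) (fa : zmod_morphism f) :
  {additive U -> V} := HB.pack f (GRing.isZmodMorphism.Build U V f fa).

Lemma subr_subrACA (V : zmodType) (a b c d : V) : a - b - (c - d) = a - c - (b - d).
Proof. by rewrite !opprB addrACA [RHS]addrACA [- b - c]addrC. Qed.

Section Extend.
Variable V : zmodType.
Implicit Types (G : set (V * QZ)) (v : V) (d : QZ).
Local Open Scope classical_set_scope.

(** The graph of a homomorphism from a subgroup of V to Q/Z. *)
Definition partial_char G :=
  [/\ G (0, 0), forall x y, G x -> G y -> G (x - y) & forall d, G (0, d) -> d = 0].

Lemma partial_charMz G x n : partial_char G -> G x -> G (x *~ n).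
Proof.
move=> [G0 GB _] Gx.
have GN y : G y -> G (- y) by move=> Gy; rewrite -sub0r; apply: GB.
have Gn k : G (x *+ k).
  by elim: k => // k IHk; rewrite mulrSr -[X in _ + X]opprK; apply: GB => //; apply: GN.
by case: (intP n) => [|k|k] //; [apply: Gn|rewrite mulrNz; apply: GN; apply: Gn].
Qed.

(** The integers n with n v in the domain are the multiples of some m; by
    divisibility choose d with m d the value at m v, and send v to d. *)
Lemma partial_char_step G v : partial_char G ->
  exists G', [/\ partial_char G', G `<=` G' & exists d, G' (v, d)].
Proof.
move=> pG; have [G0 GB Gf] := pG.
have [||m [[y Gy] mP]] := @int_subgroup (fun n => exists y, G (v *~ n, y)).
- by exists 0.
- move=> m n [y Gy] [z Gz]; exists (y - z); rewrite mulrzBr.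
  exact: (GB _ _ Gy Gz).
(* For m = 0 the value y at 0 is 0, and any d is consistent. *)
have [d dP] : exists d, d *~ m = y.
  case: (posnP m) Gy => [-> /Gf ->|m_gt0 _]; first by exists 0.
  exact: QZ_div.
pose w : V * QZ := (v, d).
have wE n : w *~ n = (v *~ n, d *~ n).
  by rewrite [LHS]surjective_pairing (raddfMz fst) (raddfMz snd).
exists (fun x => exists n, G (x - w *~ n)); split.
- split.
  + by exists 0; rewrite subr0.
  + move=> x x' [n Gn] [n' Gn']; exists (n - n'); have := GB _ _ Gn Gn'.
    by rewrite mulrzBr subr_subrACA.
  + move=> e [n Gn]; have Gn' : G (v *~ n, d *~ n - e).
      have := GB _ _ G0 Gn; rewrite sub0r opprB wE.
      by rewrite -[X in G X -> _]/(v *~ n - 0, d *~ n - e) subr0.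
    have [|q nq] := mP n; first by exists (d *~ n - e).
    apply: Gf; have := GB _ _ (partial_charMz q pG Gy) Gn'.
    rewrite -dP -wE -mulrzA mulrC -nq wE.
    rewrite -[X in G X -> _]/(v *~ n - v *~ n, d *~ n - (d *~ n - e)).
    by rewrite subrr opprB addrCA subrr addr0.
- by move=> x Gx; exists 0; rewrite subr0.
- by exists d, 1; rewrite subrr.
Qed.

(** Zorn's lemma: a maximal graph containing G has full domain by
    [partial_char_step].  The empty set is admitted in [P] because the union of
    the empty chain is empty. *)
Lemma partial_char_extend G : partial_char G ->
  exists k : {additive V -> QZ}, forall v d, G (v, d) -> k v = d.
Proof.
move=> pG.
pose P (A : set (V * QZ)) := (exists x, A x) -> G `<=` A /\ partial_char A.
have [F FP Ftot|A [PA Amax]] := @Zorn_bigcup _ P.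
  move=> [x [X FX Xx]].
  have [GX [X0 _ _]] := FP _ FX (ex_intro _ _ Xx).
  have FPx Y y : F Y -> Y y -> partial_char Y.
    by move=> FY Yy; case: (FP _ FY (ex_intro _ _ Yy)).
  split; first by move=> y /GX Xy; exists X.
  split; first by exists X.
    move=> y z [Y FY Yy] [Z FZ Zz].
    case: (Ftot _ _ FY FZ) => [YZ|ZY].
      by exists Z => //; have [_ + _] := FPx _ _ FZ Zz; apply => //; apply: YZ.
    by exists Y => //; have [_ + _] := FPx _ _ FY Yy; apply => //; apply: ZY.
  by move=> d [Y FY Yd]; have [_ _] := FPx _ _ FY Yd; apply.
have [x Ax] : exists x, A x.
  (* G itself is a nonempty member of [P], so the maximal one is not empty. *)
  apply: contrapT => /forallNP A0; apply: (Amax G); last by split.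
  split=> [x /A0 //|GA]; have [G0 _ _] := pG.
  exact: (A0 _ (GA _ G0)).
have [GA pA] := PA (ex_intro _ _ Ax); have [A0 AB Af] := pA.
have dom v : exists d, A (v, d).
  have [A' [pA' AA' [d A'd]]] := partial_char_step v pA.
  exists d; apply: contrapT => Ad; apply: (Amax A').
    by split=> // A'A; apply: Ad; apply: A'A.
  by move=> _; split=> // y /GA /AA'.
have [k kP] := choice dom.
have kA v d : A (v, d) -> k v = d.
  move=> Avd; apply/eqP; rewrite -subr_eq0; apply/eqP/Af.
  have := AB _ _ (kP v) Avd.
  by rewrite -[X in A X -> _]/(v - v, k v - d) subrr.
have ka : zmod_morphism k by move=> u v; apply: kA; exact: (AB _ _ (kP u) (kP v)).
exists (mk_additive ka) => v d Gvd /=.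
exact/kA/GA.
Qed.

(** On the subgroup generated by S and a, send S to 0 and a to a nonzero element
    of Q/Z killed by the order of a modulo S. *)
Lemma char_separate (S : V -> Prop) a : S 0 ->
  (forall x y, S x -> S y -> S (x - y)) -> ~ S a ->
  exists k : {additive V -> QZ}, (forall x, S x -> k x = 0) /\ k a != 0.
Proof.
move=> S0 SB Sa.
have [||m [Sm mP]] := @int_subgroup (fun n => S (a *~ n)) => //.
  by move=> m n Sm Sn; rewrite mulrzBr; apply: SB.
have [|d d0 dm] := @QZ_tors m.
  by apply/eqP => m1; apply: Sa; move: Sm; rewrite m1 mulr1z.
have [|k kP] := @partial_char_extend
    (fun x => exists n, S (x.1 - a *~ n) /\ x.2 = d *~ n).
  split; first by exists 0; rewrite subr0.
    move=> [x x'] [y y'] /= [n [Sn ->]] [n' [Sn' ->]]; exists (n - n').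
    rewrite !mulrzBr; split=> //; have := SB _ _ Sn Sn'.
    by rewrite subr_subrACA.
  move=> e /= [n [Sn ->]]; have [|q ->] := mP n.
    by have := SB _ _ S0 Sn; rewrite !sub0r opprK.
  by rewrite mulrC mulrzA dm mul0rz.
exists k; split=> [x Sx|]; first by apply: kP; exists 0; rewrite subr0.
by rewrite (kP a d) //; exists 1; rewrite subrr.
Qed.

Lemma char_extend (U : zmodType) (f : {additive U -> V}) (h : {additive U -> QZ}) :
  (forall u, f u = 0 -> h u = 0) ->
  exists k : {additive V -> QZ}, forall u, k (f u) = h u.
Proof.
move=> fh; have [|k kP] := @partial_char_extend (fun x => exists u, x = (f u, h u)).
  split; first by exists 0; rewrite !raddf0.
    by move=> _ _ [u ->] [u' ->]; exists (u - u'); rewrite !raddfB.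
  by move=> d [u [/esym/fh]] hu ->.
by exists k => u; apply: kP; exists u.
Qed.
End Extend.

(** * Character modules and injective modules *)

Section Char.
Variable V : zmodType.

Definition additive_fun : {pred V -> QZ} := fun f => `[< zmod_morphism f >].

Lemma additive_fun_closed : zmod_closed additive_fun.
Proof.
split=> [|f g /asboolP fa /asboolP ga]; apply/asboolP => x y; first by rewrite subr0.
by rewrite -[LHS]/(f (x - y) - g (x - y)) fa ga subr_subrACA.
Qed.
HB.instance Definition _ :=
  GRing.isZmodClosed.Build _ additive_fun additive_fun_closed.

Definition char := {f : V -> QZ | additive_fun f}.
HB.instance Definition _ := SubChoice.on char.
HB.instance Definition _ := [SubChoice_isSubZmodule of char by <:].

Definition ev (c : char) : V -> QZ := val c.
Lemma ev_is_zmod_morphism c : zmod_morphism (ev c).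
Proof. exact/asboolP/(valP c). Qed.
HB.instance Definition _ c :=
  GRing.isZmodMorphism.Build V QZ (ev c) (ev_is_zmod_morphism c).

Definition mk_char (f : V -> QZ) (fa : zmod_morphism f) : char :=
  exist _ f (asboolT fa).

Lemma charP (c d : char) : (forall x, ev c x = ev d x) -> c = d.
Proof. by move=> cd; apply/val_inj/funext. Qed.

Lemma evB c d x : ev (c - d) x = ev c x - ev d x. Proof. by []. Qed.
Lemma ev0 x : ev 0 x = 0. Proof. by []. Qed.
Lemma evD c d x : ev (c + d) x = ev c x + ev d x. Proof. by []. Qed.
Lemma char_neq0 x : x != 0 -> exists c, ev c x != 0.
Proof.
move=> x0; have [||/eqP|k [_ kx]] := @char_separate V (fun y => y = 0) x => //.
- by move=> _ _ -> ->; rewrite subr0.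
- by rewrite (negbTE x0).
- by exists (mk_char (raddfB k)).
Qed.
End Char.

Definition char_map (U V : zmodType) (f : {additive U -> V}) (c : char V) :
  char U := mk_char (raddfB (ev c \o f)).

Lemma char_mapE (U V : zmodType) (f : {additive U -> V}) (c : char V) u :
  ev (char_map f c) u = ev c (f u).
Proof. by []. Qed.

Lemma char_map_is_zmod_morphism (U V : zmodType) (f : {additive U -> V}) :
  zmod_morphism (char_map f).
Proof. by move=> c d; apply: charP. Qed.

HB.instance Definition _ (U V : zmodType) (f : {additive U -> V}) :=
  GRing.isZmodMorphism.Build _ _ (char_map f) (char_map_is_zmod_morphism f).

(** Q/Z is an injective cogenerator of abelian groups, so passing to characters
    preserves and reflects exactness. *)
Lemma char_exact (U V W : zmodType) (f : {additive U -> V}) (g : {additive V -> W}) :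
  exact_at f g <-> exact_at (char_map g) (char_map f).
Proof.
split=> [fg c|cfg y].
  split=> [cf|[d <-]].
    have [v gv|k kP] := @char_extend _ _ g (ev c).
      by have [u <-] := (fg v).1 gv; apply: (congr1 (fun c => ev c u) cf).
    by exists (mk_char (raddfB k)); apply: charP => v; apply: kP.
  by apply: charP => u; rewrite !char_mapE (fg _).2 ?raddf0 //; exists u.
split=> [gy|[u <-]].
  apply: contrapT => yf.
  have [|||k [kS /eqP ky]] := @char_separate V (fun y => exists x, f x = y) y.
  - by exists 0; rewrite raddf0.
  - by move=> _ _ [u <-] [v <-]; exists (u - v); rewrite raddfB.
  - exact: yf.
  have kf : char_map f (mk_char (raddfB k)) = 0.
    by apply: charP => u; apply: kS; exists u.
  have [d dk] := (cfg _).1 kf.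
  apply: ky; rewrite -[k y]/(ev (mk_char (raddfB k)) y) -dk.
  by rewrite -[LHS]/(ev d (g y)) gy raddf0.
apply/eqP; apply: contrapT => /negP /char_neq0[d /eqP]; apply.
by rewrite -[LHS]/(ev (char_map f (char_map g d)) u) (cfg _).2 //; exists d.
Qed.

(** The ring morphism [e] says through which ring the characters of L are a
    module: R^c itself for left modules over any R, or R when R is
    commutative. *)
Definition dual (S R : pzRingType) (e : {rmorphism S -> R^c})
  (L : lmodType R) := char L.

Section Dual.
Variables (S R : pzRingType) (e : {rmorphism S -> R^c}) (L : lmodType R).
Local Notation dual := (dual e L).

HB.instance Definition _ := GRing.Zmodule.on dual.

Definition dual_scale (s : S) (c : dual) : dual :=
  mk_char (raddfB (ev c \o *:%R (e s : R))).

Program Definition dual_lmod := GRing.Zmodule_isLmodule.Build S dual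
  (scale := dual_scale) _ _ _ _.
Next Obligation.
apply: charP => x; rewrite -[LHS]/(ev v ((e b : R) *: ((e a : R) *: x))).
by rewrite scalerA -[RHS]/(ev v ((e (a * b) : R) *: x)) rmorphM.
Qed.
Next Obligation.
move=> c; apply: charP => x; rewrite -[LHS]/(ev c ((e 1 : R) *: x)) rmorph1.
by rewrite scale1r.
Qed.
Next Obligation. by move=> s c d; apply: charP. Qed.
Next Obligation.
move=> s t; apply: charP => x.
rewrite -[LHS]/(ev v ((e (s + t) : R) *: x)).
rewrite -[RHS]/(ev v ((e s : R) *: x) + ev v ((e t : R) *: x)).
by rewrite rmorphD scalerDl raddfD.
Qed.
HB.instance Definition _ := dual_lmod.

End Dual.

Section DualMap.
Variables (S R : pzRingType) (e : {rmorphism S -> R^c}).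

Lemma char_map_linear (A B : lmodType R) (f : {linear A -> B}) :
  linear (char_map f : dual e B -> dual e A).
Proof.
move=> s c d; apply: charP => x.
rewrite -[LHS]/(ev c ((e s : R) *: f x) + ev d (f x)).
by rewrite -[RHS]/(ev c (f ((e s : R) *: x)) + ev d (f x)) linearZ.
Qed.

Definition dual_map (A B : lmodType R) (f : {linear A -> B}) :
  {linear dual e B -> dual e A} := mk_linear (char_map_linear f).

Lemma dual_mses (A B C : lmodType R) (f : {linear A -> B}) (g : {linear B -> C}) :
  mses f g -> mses (dual_map g) (dual_map f).
Proof.
move=> [fi ex sg]; split.
- apply: inj0 => c gc; apply: charP => z; have [y <-] := sg z.
  exact: (congr1 (fun c : dual e B => ev c y) gc).
- exact/(char_exact f g).
move=> c; have [x fx|k kP] := @char_extend _ _ f (ev c).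
  by rewrite (fi x 0) ?raddf0.
by exists (mk_char (raddfB k) : dual e B); apply: charP => x; apply: kP.
Qed.

Lemma dual_mod_ses (A B C : lmodType R) :
  mod_ses A B C -> mod_ses (dual e C : lmodType S) (dual e B) (dual e A).
Proof. by move=> [f [g /dual_mses]]; exists (dual_map g), (dual_map f). Qed.
End DualMap.

Section ComRing.
Variable R : comPzRingType.
Implicit Types A B C X Y M N P : lmodType R.

(** The identity, which is a ring morphism to R^c when R is commutative. *)
Definition to_conv (x : R) : R^c := x.
Lemma to_conv_is_zmod_morphism : zmod_morphism to_conv. Proof. by []. Qed.
Lemma to_conv_is_monoid_morphism : monoid_morphism to_conv.
Proof. by split=> // x y; apply: mulrC. Qed.
HB.instance Definition _ :=
  GRing.isZmodMorphism.Build R R^c to_conv to_conv_is_zmod_morphism.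
HB.instance Definition _ :=
  GRing.isMonoidMorphism.Build R R^c to_conv to_conv_is_monoid_morphism.

Definition cdual X : lmodType R := dual to_conv X.

(** Both sides are the pairings of X and Y with values in Q/Z that are balanced
    over R. *)
Lemma swap_linear X Y (h : {linear Y -> cdual X}) :
  exists k : {linear X -> cdual Y}, forall x y, ev (k x) y = ev (h y) x.
Proof.
have ka x : zmod_morphism (fun y => ev (h y) x).
  by move=> y y'; rewrite raddfB.
have lk : linear (fun x => mk_char (ka x) : cdual Y).
  move=> r x x'; apply: charP => y.
  rewrite -[LHS]/(ev (h y) (r *: x + x')).
  rewrite -[RHS]/(ev (h (r *: y)) x + ev (h y) x') raddfD; congr (_ + _).
  by rewrite linearZ.
by exists (mk_linear lk).
Qed.

(** By [swap_linear], extending a map to the dual of P along g amounts to lifting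
    a map from P along the dual of g, which is surjective. *)
Lemma injective_dual P : projective P -> injective_module (cdual P).
Proof.
move=> pP M N g h gi.
have [k kP] := swap_linear h.
have [|l lP] := pP _ _ (dual_map to_conv g : {linear cdual N -> cdual M}) k.
  have [C [q [sq eq]]] := coker_ex g.
  by have [] : mses (dual_map to_conv q) (dual_map to_conv g) by apply: dual_mses.
have [m mP] := swap_linear l; exists m => x; apply: charP => p.
rewrite mP -kP -lP //.
Qed.

Lemma bidual_ex X : exists i : {linear X -> cdual (cdual X)},
  injective i /\ forall x c, ev (i x) c = ev c x.
Proof.
have [i iP] := swap_linear (idfun : {linear cdual X -> cdual X}).
exists i; split=> //; apply: inj0 => x ix; apply: contrapT => /eqP/char_neq0[c /eqP].
by rewrite -[ev c x](iP x c) ix.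
Qed.

(** X embeds in its bidual, which embeds in the dual of a free module that covers
    the dual of X. *)
Lemma mod_enough_inj X : exists I C, (forall Y, mod_orth Y I) /\ mod_ses X I C.
Proof.
have [K [F [pF /(dual_mod_ses to_conv) [i [q [ii _ _]]]]]] := mod_enough_proj (cdual X).
have [j [ji _]] := bidual_ex X.
have [C [p [sp ep]]] := coker_ex (i \o j).
exists (cdual F), C; split; first exact/injectiveP/injective_dual/projectiveP.
by exists (i \o j), p; split=> //; apply: inj_comp.
Qed.

Lemma mod_axioms : axioms (Mod R).
Proof.
split; split.
- exact: mod_enough_proj.
- exact: mod_orth_mid.
- exact: mod_orth_shift.
- exact: mod_orth_retract.
- exact: mod_pushout.
- exact: mod_quotient.
- exact: mod_extend.
- exact: mod_sum.
- move=> X; have [I [C [iI XIC]]] := mod_enough_inj X; by exists C, I.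
- by move=> A B C Y ABC ? ?; apply: mod_orth_mid_op ABC _ _.
- by move=> X' P X Y I Y' a b o1 o2 o3; apply: mod_orth_shift_op b a _ _ _.
- by move=> A B C Y a b c; apply: mod_orth_retract_op a b c.
- by move=> K G M H G' a b; apply: mod_pullback a b.
- by move=> H E M P G a b; apply: mod_subobject a b.
- by move=> I E C J C' a b c; apply: mod_coextend a b c.
- by move=> A B; apply: mod_sum.
Qed.
End ComRing.

(** * Absolutely clean modules and level modules *)

Section Resolutions.
Variable R : pzRingType.
Implicit Types (F A L M N : lmodType R) (P : nat -> lmodType R).

Lemma resolution_syzygy F P (d : forall i, {linear P i.+1 -> P i})
    (eps : {linear P 0%N -> F}) : is_resolution d eps ->
  exists (K : lmodType R) (f : {linear K -> P 0%N}) (eps' : {linear P 1%N -> K}),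
    [/\ mses f eps, is_resolution (P := P \o S) (fun i => d i.+1) eps' &
        forall x, f (eps' x) = d 0%N x].
Proof.
move=> [se e0 ed]; have [K [f [fi ef]]] := ker_ex eps.
have [//|x|eps' epsE] := @mono_factor _ _ _ _ f (d 0%N).
  by apply/ef/e0; exists x.
exists K, f, eps'; split=> //; split=> [k|x|i]; last exact: ed.
- have /e0[x dx] : eps (f k) = 0 by apply/ef; exists k.
  by exists x; apply: fi; rewrite epsE.
- have := ed 0%N x; rewrite -epsE => <-.
  by split=> [->|fx]; [rewrite linear0|apply: fi; rewrite fx linear0].
Qed.

(** Ext^1 computed from one projective resolution agrees with splitting of
    extensions; in particular it does not depend on the resolution. *)
Lemma hom_to_exactP F A P (d : forall i, {linear P i.+1 -> P i})
    (eps : {linear P 0%N -> F}) : is_resolution d eps ->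
  projective (P 0%N) -> hom_to_exact (d 1%N) (d 0%N) A <-> mod_orth F A.
Proof.
move=> res /projectiveP pP.
have [K [f [q [fe [sq eq _] qE]]]] := resolution_syzygy res.
split=> [hex|o h hd].
  apply: (mod_orth_of_extend fe) => // h; have [x|k kP] := hex (h \o q).
    by rewrite /= (eq _).2 ?linear0 //; exists x.
  exists k => z; have [x <-] := sq z; by rewrite qE.
have [//|_ /eq[x <-]|k kP] := @epi_factor _ _ _ _ q h; first exact: hd.
have [l lP] := mod_orth_extend k o fe.
by exists l => x; rewrite -qE lP.
Qed.

Lemma FP_infty_syzygy F : FP_infty F ->
  exists K Q, [/\ projective Q, mod_ses K Q F & FP_infty K].
Proof.
move=> [P [d [eps [res fp]]]].
have [K [f [q [fe resK _]]]] := resolution_syzygy res.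
exists K, (P 0%N); split; [by have [] := fp 0%N|by exists f, eps|].
by exists (P \o S), (fun i => d i.+1), q; split=> // i; apply: fp i.+1.
Qed.

Lemma absolutely_cleanP A :
  absolutely_clean A <-> forall F, FP_infty F -> mod_orth F A.
Proof.
split=> acA F FP; last first.
  by move=> P d eps res pP; apply/(hom_to_exactP A res (pP 0%N))/acA.
have [P [d [eps [res fp]]]] := FP.
have pP i : projective (P i) by have [] := fp i.
exact/(hom_to_exactP A res (pP 0%N))/(acA F FP P d eps res pP).
Qed.
End Resolutions.

Section TensorChar.
Variables (R : pzRingType) (L : lmodType R).
Local Notation dualc := (dual (idfun : {rmorphism R^c -> R^c})).

Lemma freeg_additive_eq (K : choiceType) (G : zmodType)
    (h h' : {additive {freeg K} -> G}) :
  (forall x, h << x >> = h' << x >>) -> h =1 h'.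
Proof.
move=> hh' D; rewrite -[D]freeg_sumE !raddf_sum; apply: eq_bigr => x _ /=.
by rewrite -[coeff x D]intz -freegU_mulz !raddfMz /= hh'.
Qed.

Section OneModule.
Variable M : lmodType R^c.
Local Notation pi := (\pi_(tensor M L)).

Lemma tensor_piE x y : tensor_rel (x - y) -> pi x = pi y.
Proof.
move=> xy; apply/eqP; have <- := Quotient.idealrBE (@tensor_relb R M L) x y.
exact/asboolP.
Qed.

Lemma tensor_repr x : tensor_rel (repr (pi x) - x).
Proof.
apply/asboolP; have := Quotient.idealrBE (@tensor_relb R M L) (repr (pi x)) x.
by rewrite reprK eqxx.
Qed.

Lemma tensor_piB x y : pi (x - y) = pi x - pi y.
Proof. exact: pi_is_zmod_morphism. Qed.

Lemma tensor_char_eq (c c' : char (tensor M L)) :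
  (forall m l, ev c (tpure m l) = ev c' (tpure m l)) -> c = c'.
Proof.
move=> cc'; apply: charP => t; rewrite -[t]reprK.
have pia (k : char (tensor M L)) : zmod_morphism (fun x => ev k (pi x)).
  by move=> x y; rewrite tensor_piB raddfB.
apply: (freeg_additive_eq (h := mk_additive (pia c)) (h' := mk_additive (pia c'))).
by case=> m l; apply: cc'.
Qed.

Lemma tensor_char_bilinear (c : char (tensor M L)) :
  exists h : {linear M -> dualc L}, forall m l, ev (h m) l = ev c (tpure m l).
Proof.
have ka : zmod_morphism (fun x => ev c (pi x)).
  by move=> x y; rewrite tensor_piB raddfB.
pose k := mk_additive ka.
have kE x y : tensor_rel (x - y) -> k x = k y.
  by move=> xy; rewrite /k /= (tensor_piE xy).
have kr m : zmod_morphism (fun l => k (tgen m l)).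
  move=> l l'; apply/eqP; rewrite eq_sym subr_eq -raddfD; apply/eqP.
  by rewrite -[in LHS](subrK l' l); apply/kE/TRelDr.
have kl : linear (fun m => mk_char (kr m) : dualc L).
  move=> r m m'; apply: charP => l; rewrite -[LHS]/(k (tgen (r *: m + m') l)).
  rewrite -[RHS]/(k (tgen m ((r : R) *: l)) + k (tgen m' l)).
  rewrite (kE _ _ (TRelDl _ _ _)) raddfD; congr (_ + _).
  by apply: kE; apply: TRelZ.
by exists (mk_linear kl).
Qed.

Lemma bilinear_tensor_char (h : {linear M -> dualc L}) :
  exists c : char (tensor M L), forall m l, ev c (tpure m l) = ev (h m) l.
Proof.
(* [fglift] takes values in a module over the integers. *)
pose phi : {freeg (M * L)%type} -> zmodule QZ :=
  fglift (fun ml => ev (h ml.1) ml.2 : zmodule QZ).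
have phiB : zmod_morphism phi by apply: lift_is_additive.
have phi_gen m l : phi (tgen m l) = ev (h m) l by rewrite /phi liftU scale1r.
pose phi' := mk_additive phiB.
have phi_rel x : tensor_rel x -> phi' x = 0.
  elim=> {x} [m m' n|m n n'|m r n||x y _ px _ py].
  - by rewrite !raddfB raddfD /= !phi_gen linearD evD subrr.
  - by rewrite !raddfB raddfD /= !phi_gen raddfD subrr.
  - by rewrite !raddfB /= !phi_gen linearZ subrr.
  - exact: raddf0.
  - by rewrite raddfB px py subrr.
have phi_repr x : phi' (repr (pi x)) = phi' x.
  by apply/eqP; rewrite -subr_eq0 -raddfB phi_rel //; apply: tensor_repr.
have ca : zmod_morphism (fun t : tensor M L => phi' (repr t) : QZ).
  move=> s t; rewrite -{1}[s]reprK -{1}[t]reprK -tensor_piB phi_repr.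
  exact: raddfB.
exists (mk_char ca) => m l; rewrite -phi_gen.
exact: phi_repr.
Qed.
End OneModule.

(** Characters of a tensor product with L are the linear maps to the dual of L,
    and characters detect exactness. *)
Lemma tensor_exactP (U V W : lmodType R^c) (f : {linear U -> V}) (g : {linear V -> W}) :
  (forall u, g (f u) = 0) ->
  exact_at (tensor_map (N := L) f) (tensor_map (N := L) g) <->
  hom_to_exact f g (dualc L).
Proof.
move=> gf; rewrite (char_exact (tensor_map f) (tensor_map g)).
have mapE (A B : lmodType R^c) (k : {linear A -> B}) (c : char (tensor B L)) m l :
    ev (char_map (tensor_map k) c) (tpure m l) = ev c (tpure (k m) l).
  by rewrite char_mapE /= tensor_map_pure.
split=> [ex h hf|hex c].
  have [c cP] := bilinear_tensor_char h.
  have [|d dc] := (ex c).1.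
    by apply: tensor_char_eq => u l; rewrite mapE cP hf.
  have [k kP] := tensor_char_bilinear d; exists k => v; apply: charP => l.
  by rewrite kP -mapE dc cP.
split=> [cf|[d <-]]; last first.
  apply: tensor_char_eq => u l; rewrite !mapE gf.
  by have [k kP] := tensor_char_bilinear d; rewrite -kP linear0.
have [h hP] := tensor_char_bilinear c.
have [u|k kP] := hex h.
  by apply: charP => l; rewrite hP -mapE cf.
have [d dP] := bilinear_tensor_char k; exists d.
by apply: tensor_char_eq => v l; rewrite mapE dP kP hP.
Qed.

Lemma levelP : level L <-> absolutely_clean (dualc L : lmodType R^c).
Proof.
have iff (F : lmodType R^c) (P : nat -> lmodType R^c)
    (d : forall i, {linear P i.+1 -> P i}) (eps : {linear P 0%N -> F}) :
    is_resolution d eps -> exact_at (tensor_map (N := L) (d 1%N))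
      (tensor_map (N := L) (d 0%N)) <-> hom_to_exact (d 1%N) (d 0%N) (dualc L).
  move=> [_ _ ed]; apply: tensor_exactP => x.
  by apply/(ed 0%N); exists x.
by split=> h F FP P d eps res pP; apply/(iff _ _ _ _ res); apply: h res pP.
Qed.
End TensorChar.

Section SemilinearTransfer.
Lemma mod_orth_iso (R : pzRingType) (X A B : lmodType R) (f : {linear A -> B})
    (g : {linear B -> A}) : cancel f g -> cancel g f -> mod_orth X A -> mod_orth X B.
Proof.
move=> fK gK o E i q iq; have [ii ex sq] := iq.
have [|r rP] := o E (i \o f) q; last first.
  by exists (f \o r) => b /=; rewrite -{1}(gK b) -[i _]/((i \o f) (g b)) rP.
split=> // [|e]; first exact: inj_comp (can_inj fK).
rewrite ex; split=> [[b <-]|[a <-]]; first by exists (g b); rewrite /= gK.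
by exists (f a).
Qed.

(** Rings equal as structures have the same modules, so a bijection that is
    semilinear along [e] becomes an isomorphism once [e] is eliminated. *)
Lemma absolutely_clean_semilinear (S R : pzRingType) (e : S = R) (N : lmodType S)
    (M : lmodType R) (f : N -> M) (g : M -> N) :
  cancel f g -> cancel g f -> zmod_morphism f ->
  (forall s x, f (s *: x) = eq_rect S (fun T : pzRingType => T) s R e *: f x) ->
  absolutely_clean N -> absolutely_clean M.
Proof.
case: R / e M f g => M f g fK gK fB fZ /absolutely_cleanP acN.
have lf : linear f.
  pose f' := mk_additive fB; move=> a x y.
  by rewrite -fZ; apply: (raddfD f').
have lg : linear g by move=> a x y; apply: (can_inj fK); rewrite lf !gK.
apply/absolutely_cleanP => F FP; have := acN F FP.
exact: (mod_orth_iso (f := mk_linear lf) (g := mk_linear lg)).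
Qed.

(** Transport of elements along an equality of ring structures depends on the
    carriers only. *)
Lemma eq_rect_ring (S R : pzRingType) (e : S = R) (e' : (S : Type) = R) (s : S) :
  eq_rect S (fun T : pzRingType => T : Type) s R e = eq_rect (S : Type) id s R e'.
Proof. by case: R / e e' => e'; rewrite (Prop_irrelevance e' erefl). Qed.
End SemilinearTransfer.

(** For commutative R the ring structures of R and R^c differ only in a
    multiplication that is the same function.  This identifies right modules
    with left modules without a conversion of each notion. *)
Lemma converse_ring_eq (R : comPzRingType) : (R^c : pzRingType) = R :> pzRingType.
Proof.
have com : (fun x y : R => y * x) = *%R.
  by apply/funext => x; apply/funext => y; apply: mulrC.
case: R com => T [a1 a2 b c d e f g h [o m p1 p2 p3 p4 p5 p6 p7] com] /= E.
pose B (i : GRing.Nmodule_isPzSemiRing.axioms_ T a2 b d e f g h) :=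
  GRing.PzRing.Pack (GRing.PzRing.Class c i).
suff aux m' q1 q2 q3 q4 q5 q6 q7 : m' = m ->
    B (GRing.Nmodule_isPzSemiRing.Axioms_ o m' q1 q2 q3 q4 q5 q6 q7) =
    B (GRing.Nmodule_isPzSemiRing.Axioms_ o m p1 p2 p3 p4 p5 p6 p7).
  exact: (aux (fun x y => m y x) _ _ _ _ _ _ _ E).
move=> ?; subst m'; congr (B (GRing.Nmodule_isPzSemiRing.Axioms_ o m _ _ _ _ _ _ _));
  exact: Prop_irrelevance.
Qed.

Lemma level_dualP (R : comPzRingType) (L : lmodType R) :
  level L <-> absolutely_clean (cdual L).
Proof.
have cast (e : (R^c : pzRingType) = R) r :
    eq_rect _ (fun T : pzRingType => T : Type) r _ e = r.
  by rewrite (eq_rect_ring e erefl).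
have cast' (e : (R : pzRingType) = R^c) r :
    eq_rect _ (fun T : pzRingType => T : Type) r _ e = r.
  by rewrite (eq_rect_ring e erefl).
rewrite levelP; split.
  apply: (@absolutely_clean_semilinear _ _ (converse_ring_eq R)
    (dual (idfun : {rmorphism R^c -> R^c}) L) (cdual L) id id) => //.
  by move=> r x; rewrite cast.
apply: (@absolutely_clean_semilinear _ _ (esym (converse_ring_eq R)) (cdual L)
    (dual (idfun : {rmorphism R^c -> R^c}) L) id id) => //.
by move=> r x; rewrite cast'.
Qed.

(** * Biduals and modules of type FP_oo *)

Section HomGroup.
Variables (R : pzRingType) (P A : lmodType R).

Definition linear_fun : {pred P -> A} := fun f => `[< linear f >].

Lemma linear_fun_closed : zmod_closed linear_fun.
Proof.
split=> [|f g /asboolP fl /asboolP gl]; apply/asboolP => a x y.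
  by rewrite -[LHS]/(0 : A) -[RHS]/(a *: (0 : A) + 0) scaler0 addr0.
rewrite -[LHS]/(f (a *: x + y) - g (a *: x + y)) fl gl.
by rewrite -[RHS]/(a *: (f x - g x) + (f y - g y)) scalerBr opprD addrACA.
Qed.
HB.instance Definition _ :=
  GRing.isZmodClosed.Build _ linear_fun linear_fun_closed.

(** The group of linear maps as a subgroup of the functions, so that its
    characters make sense. *)
Definition hom := {f : P -> A | linear_fun f}.
HB.instance Definition _ := SubChoice.on hom.
HB.instance Definition _ := [SubChoice_isSubZmodule of hom by <:].

Definition app (f : hom) : {linear P -> A} := mk_linear (asboolW (valP f)).
Definition mk_hom (f : {linear P -> A}) : hom := exist _ (f : P -> A) (asboolT (linearP f)).

Lemma appB f g x : app (f - g) x = app f x - app g x. Proof. by []. Qed.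
Lemma homP (f g : hom) : (forall x, app f x = app g x) -> f = g.
Proof. by move=> fg; apply/val_inj/funext. Qed.
End HomGroup.

Section HomMap.
Variables (R : pzRingType) (A : lmodType R).
Definition hom_map (P Q : lmodType R) (d : {linear P -> Q}) (f : hom Q A) : hom P A :=
  mk_hom (app f \o d).
Lemma hom_map_is_zmod_morphism (P Q : lmodType R) (d : {linear P -> Q}) :
  zmod_morphism (hom_map d).
Proof. by move=> f g; apply: homP. Qed.
HB.instance Definition _ (P Q : lmodType R) (d : {linear P -> Q}) :=
  GRing.isZmodMorphism.Build _ _ (hom_map d) (hom_map_is_zmod_morphism d).

Lemma hom_map_exact (P Q S : lmodType R) (f : {linear P -> Q}) (g : {linear Q -> S}) :
  (forall x, g (f x) = 0) ->
  exact_at (hom_map g) (hom_map f) <-> hom_to_exact f g A.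
Proof.
move=> gf; split=> [ex h hf|ex h].
  have [|k kh] := (ex (mk_hom h)).1; first by apply: homP => x; apply: hf.
  by exists (app k) => y; apply: (congr1 (fun h => app h y) kh).
split=> [hf|[k <-]]; last first.
  by apply: homP => x; rewrite -[LHS]/(app k (g (f x))) gf linear0.
have [x|k kP] := ex (app h); first exact: (congr1 (fun h => app h x) hf).
by exists (mk_hom k); apply: homP.
Qed.
End HomMap.
Arguments hom_map {R} A {P Q} d f.

Lemma dual_basis (R : pzRingType) (P : lmodType R) : projective P -> finitely_generated P ->
  exists n (e : 'I_n -> P) (u : 'I_n -> P -> R),
    (forall i, scalar (u i)) /\ forall x, x = \sum_i u i x *: e i.
Proof.
move=> pP [n [e eP]]; pose F : lmodType R := 'I_n -> R^o.
have l : linear (fun c : F => \sum_i (c i : R) *: e i).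
  move=> a c d; rewrite scaler_sumr -big_split; apply: eq_bigr => i _ /=.
  by rewrite -[(a *: c + d) i]/(a * c i + d i) scalerDl scalerA.
have [|s sP] := pP _ _ (mk_linear l) idfun.
  by move=> x; have [c ->] := eP x; exists c.
exists n, e, (fun i x => s x i); split=> [i a x y|x]; last by rewrite -[LHS]sP.
by rewrite linearP.
Qed.

Section Bidual.
Variables (R : comPzRingType) (A : lmodType R).

Section Theta.
Variable P : lmodType R.

(** The natural comparison of the double character group of Hom(P, A) with
    Hom(P, A^{++}).  As a relation it needs no choice of the character of
    Hom(P, A) that evaluates at p and then applies a. *)
Definition bidual_rel (X : char (char (hom P A))) (h : P -> cdual (cdual A)) :=
  forall p (a : cdual A) (c : char (hom P A)),
    (forall f, ev c f = ev a (app f p)) -> ev (h p) a = ev X c.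

Lemma eval_char p (a : cdual A) :
  exists c : char (hom P A), forall f, ev c f = ev a (app f p).
Proof.
have ca : zmod_morphism (fun f : hom P A => ev a (app f p)).
  by move=> f g; rewrite appB raddfB.
by exists (mk_char ca).
Qed.

Lemma bidual_rel_ex X : exists h : {linear P -> cdual (cdual A)}, bidual_rel X h.
Proof.
have [c0 c0E] := choice (fun pa : P * cdual A => eval_char pa.1 pa.2).
pose c p a := c0 (p, a).
have cE p a f : ev (c p a) f = ev a (app f p) by apply: c0E.
have ka p : zmod_morphism (fun a : cdual A => ev X (c p a)).
  by move=> a b; rewrite -raddfB; congr (ev X _); apply: charP => f; rewrite evB !cE.
have l : linear (fun p => mk_char (ka p) : cdual (cdual A)).
  move=> r p q; apply: charP => a; rewrite -[LHS]/(ev X (c (r *: p + q) a)).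
  rewrite -[RHS]/(ev X (c p (r *: a)) + ev X (c q a)) -raddfD.
  congr (ev X _); apply: charP => f; rewrite evD !cE linearP raddfD.
  by congr (_ + _).
exists (mk_linear l) => p a c' c'E; rewrite -[LHS]/(ev X (c p a)).
by congr (ev X _); apply: charP => f; rewrite c'E cE.
Qed.

Lemma bidual_rel_fun X (h k : P -> cdual (cdual A)) :
  bidual_rel X h -> bidual_rel X k -> h =1 k.
Proof.
move=> Xh Xk p; apply: charP => a; have [c cE] := eval_char p a.
by rewrite (Xh _ _ _ cE) (Xk _ _ _ cE).
Qed.

Hypotheses (pP : projective P) (fP : finitely_generated P).

(** In dual bases e, u of P, a map f is the sum of the maps sending p to
    u_i(p) f(e_i), so a character c of Hom(P, A) is determined by the
    characters of A that send x to c(u_i x). *)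
Lemma hom_char_coords : exists n (e : 'I_n -> P) (u : 'I_n -> P -> R)
    (al : 'I_n -> char (hom P A) -> cdual A),
  [/\ (forall x, x = \sum_i u i x *: e i),
      (forall i, zmod_morphism (al i)),
      (forall c f, ev c f = \sum_i ev (al i c) (app f (e i))) &
      forall c p (a : cdual A), (forall f, ev c f = ev a (app f p)) ->
        forall i, al i c = u i p *: a].
Proof.
have [n [e [u [ul eP]]]] := dual_basis pP fP.
have ml i (a : A) : linear (fun p => u i p *: a).
  by move=> r x y; rewrite ul scalerDl scalerA.
pose m i a := mk_hom (mk_linear (ml i a)).
have mB i a b : m i (a - b) = m i a - m i b.
  by apply: homP => p; rewrite appB /= scalerBr.
have ca i (c : char (hom P A)) : zmod_morphism (fun a => ev c (m i a)).
  by move=> a b; rewrite mB raddfB.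
exists n, e, u, (fun i c => mk_char (ca i c) : cdual A); split=> [//|i c d|c f|c p a cE i].
- by apply: charP.
- have {1}-> : f = \sum_i m i (app f (e i)).
    apply: homP => p; rewrite {1}(eP p) linear_sum.
    have -> : app (\sum_i m i (app f (e i))) p = \sum_i app (m i (app f (e i))) p.
      by apply: (big_morph (fun g : hom P A => app g p)) => // g h.
    by apply: eq_bigr => i _; rewrite linearZ.
  by rewrite raddf_sum.
- by apply: charP => x; rewrite -[LHS]/(ev c (m i x)) cE.
Qed.

Lemma bidual_rel_surj (h : {linear P -> cdual (cdual A)}) : exists X, bidual_rel X h.
Proof.
have [n [e [u [al [eP alB _ alE]]]]] := hom_char_coords.
have Xa : zmod_morphism (fun c => \sum_i ev (h (e i)) (al i c)).
  by move=> c d; rewrite -sumrB; apply: eq_bigr => i _; rewrite alB raddfB.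
exists (mk_char Xa) => p a c cE.
rewrite -[RHS]/(\sum_i ev (h (e i)) (al i c)) {1}(eP p) linear_sum.
have -> : ev (\sum_i h (u i p *: e i)) a = \sum_i ev (h (u i p *: e i)) a.
  by apply: (big_morph (fun g : cdual (cdual A) => ev g a)) => // g h'.
by apply: eq_bigr => i _; rewrite linearZ (alE c p a cE).
Qed.

Lemma bidual_rel_inj X Y h : bidual_rel X h -> bidual_rel Y h -> X = Y.
Proof.
move=> Xh Yh; apply: charP => c; have [n [e [u [al [eP alB cE _]]]]] := hom_char_coords.
have ba i : zmod_morphism (fun f : hom P A => ev (al i c) (app f (e i))).
  by move=> f g; rewrite appB raddfB.
have -> : c = \sum_i mk_char (ba i).
  apply: charP => f; rewrite cE.
  by rewrite (big_morph (fun g : char _ => ev g f) (id1 := 0) (op1 := +%R)).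
rewrite !raddf_sum; apply: eq_bigr => i _.
by transitivity (ev (h (e i)) (al i c)); [apply/esym/Xh|apply: Yh].
Qed.
End Theta.

Lemma bidual_rel_nat (U V : lmodType R) (f : {linear U -> V}) X (h : V -> cdual (cdual A)) :
  bidual_rel X h -> bidual_rel (char_map (char_map (hom_map A f)) X) (h \o f).
Proof.
by move=> Xh p a c cE; apply: (Xh (f p) a (char_map (hom_map A f) c)) => g; apply: cE.
Qed.

(** For finitely generated projective modules [bidual_rel] is a natural bijection,
    and taking characters twice preserves and reflects exactness of
    Hom(W, A), Hom(V, A), Hom(U, A). *)
Lemma bidual_exact (U V W : lmodType R) (f : {linear U -> V}) (g : {linear V -> W}) :
  projective U -> finitely_generated U -> projective V -> finitely_generated V ->
  projective W -> finitely_generated W -> (forall x, g (f x) = 0) ->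
  hom_to_exact f g A <-> hom_to_exact f g (cdual (cdual A)).
Proof.
move=> pU fU pV fV pW fW gf; rewrite -hom_map_exact // char_exact char_exact.
have zero_rel (M : lmodType R) (h : M -> cdual (cdual A)) :
    (forall x, h x = 0) -> bidual_rel 0 h.
  by move=> h0 p a c _; rewrite h0 !ev0.
split=> [ex h hf|ex X].
  have [X Xh] := bidual_rel_surj pV fV h.
  have [|Z ZX] := (ex X).1.
    by apply: (bidual_rel_inj pU fU (bidual_rel_nat f Xh)); apply: zero_rel.
  have [k Zk] := bidual_rel_ex Z; exists k.
  by apply: (bidual_rel_fun (bidual_rel_nat g Zk)); rewrite ZX.
split=> [Xf|[Z <-]]; last first.
  apply: charP => c; rewrite -[LHS]/(ev Z (char_map (hom_map A g) (char_map (hom_map A f) c))).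
  have -> : char_map (hom_map A g) (char_map (hom_map A f) c) = 0; last exact: raddf0.
  apply: charP => k; rewrite -[LHS]/(ev c (hom_map A f (hom_map A g k))).
  have -> : hom_map A f (hom_map A g k) = 0; last exact: raddf0.
  by apply: homP => x; rewrite -[LHS]/(app k (g (f x))) gf linear0.
have [h Xh] := bidual_rel_ex X.
have [|k kP] := ex h.
  apply: (bidual_rel_fun (bidual_rel_nat f Xh)).
  rewrite -[char_map _ X]/(char_map (char_map (hom_map A f)) X) Xf.
  exact: zero_rel.
have [Z Zk] := bidual_rel_surj pW fW k; exists Z.
apply: (bidual_rel_inj pV fV (h := h)) => //.
move=> p a c cE; rewrite -kP; exact: bidual_rel_nat cE.
Qed.

Lemma FP_infty_bidual F : FP_infty F -> mod_orth F A <-> mod_orth F (cdual (cdual A)).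
Proof.
move=> [P [d [eps [res fp]]]]; have [p0 f0] := fp 0%N.
have [[p1 f1] [p2 f2]] := (fp 1%N, fp 2%N).
rewrite -!(hom_to_exactP _ res) //; apply: bidual_exact => // x.
by have [_ _ ed] := res; apply/(ed 0%N); exists x.
Qed.
End Bidual.

(** * Transfer between the two global dimensions *)

Section Transfer.
Variable R : comPzRingType.
Implicit Types A B C F K L M X Y I P : lmodType R.
Let axM := mod_axioms R.

Lemma ac_injective I : injective_module I -> absolutely_clean I.
Proof. by move/injectiveP=> iI; apply/absolutely_cleanP. Qed.

Lemma level_projective P : projective P -> level P.
Proof. by move=> pP; apply/level_dualP/ac_injective/injective_dual. Qed.

Lemma level_dual A : absolutely_clean A -> level (cdual A).
Proof.
move=> /absolutely_cleanP acA; apply/level_dualP/absolutely_cleanP => F FP.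
exact/(FP_infty_bidual A FP)/acA.
Qed.

(** Each step passes to a syzygy of A and to the cosyzygy dual to it; at the end
    the dual is injective, hence absolutely clean. *)
Lemma level_resolution n A : (forall M, @ext (Mod R) n M (cdual A)) ->
  @tres (Mod R) (@level R) n A.
Proof.
elim: n A => [|n IHn] A /= eA.
  exact/level_dualP/ac_injective/injectiveP.
have [K [P [pP KPA]]] := mod_enough_proj A.
exists K, P; split=> //; first exact/level_projective/projectiveP.
apply: IHn => M; apply: (eA M (cdual P)); last exact: dual_mod_ses KPA.
exact/injectiveP/injective_dual/projectiveP.
Qed.

(** The dual of a projective resolution is an injective coresolution. *)
Lemma dual_id n X : (forall Y, @ext (Mod R) n X Y) ->
  forall M, @ext (Mod R) n M (cdual X).
Proof.
elim: n X => [|n IHn] X eX M.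
  exact: ((injectiveP _).1 (injective_dual ((projectiveP _).2 eX))).
have [K [P [pP KPX]]] := mod_enough_proj X.
have DPi : @inj (Mod R) (cdual P) by apply/injectiveP/injective_dual/projectiveP.
have DKPX : @ses (op (Mod R)) (cdual K) (cdual P) (cdual X) by apply: dual_mod_ses KPX.
apply/(ext_op axM)/(ext_shift_proj (axioms_op axM) n _ DPi DKPX)/(ext_op axM).
by apply: IHn => Y; apply/(ext_shift_proj axM _ _ pP KPX).
Qed.

Lemma ext_bidual n F L : FP_infty F -> @ext (Mod R) n F (cdual (cdual L)) ->
  @ext (Mod R) n F L.
Proof.
elim: n F => [|n IHn] F FP eF; first exact/(FP_infty_bidual L FP).
have [K [Q [/projectiveP pQ KQF FPK]]] := FP_infty_syzygy FP.
apply/(ext_shift_proj axM n _ pQ KQF)/IHn => //.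
exact/(ext_shift_proj axM n _ pQ KQF).
Qed.

Lemma absolutely_clean_coresolution n L : (forall F, FP_infty F -> @ext (Mod R) n F L) ->
  @tres (op (Mod R)) (@absolutely_clean R) n L.
Proof.
elim: n L => [|n IHn] L /= eL; first exact/absolutely_cleanP.
have [I [C [iI LIC]]] := mod_enough_inj L.
exists C, I; split=> //; first exact/ac_injective/injectiveP.
by apply: IHn => F FP; apply: eL LIC.
Qed.

(** Both directions bound the projective dimension of absolutely clean modules
    and the injective dimension of level modules by n, then apply [gdim_all]
    in the structure at hand. *)
Lemma gdim_transfer n : (forall M, @gdim (Mod R) (@level R) n M) <->
  (forall M, @gdim (op (Mod R)) (@absolutely_clean R) n M).
Proof.
have projL P : @proj (Mod R) P -> level P by move/projectiveP/level_projective.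
have injA I : @proj (op (Mod R)) I -> absolutely_clean I.
  by move/injectiveP/ac_injective.
split=> dim M.
  (* Level modules have injective dimension at most n; duals of absolutely clean
     modules are level, so that [level_resolution] applies to the latter. *)
  have id L : level L -> forall Y, @ext (Mod R) n Y L.
    by move=> lL Y; apply: (gdim_ext axM (dim Y) lL).
  apply: (gdim_all (axioms_op axM)) => [A acA Y|P pP Y].
    apply/(ext_op axM)/(gdim_tres_ext axM projL (dim A) (m := n)).
    apply: level_resolution => X; exact/id/level_dual.
  exact/(ext_op axM)/id/projL.
have pd A : absolutely_clean A -> forall Y, @ext (Mod R) n A Y.
  by move=> acA Y; apply/(ext_op axM)/(gdim_ext (axioms_op axM) (dim Y) acA).
apply: (gdim_all axM) => [L lL Y|I iI Y]; last exact/pd/injA.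
(* The bound on the dual of L, which is absolutely clean, passes to the bidual
   and from there to L itself, tested against modules of type FP_oo. *)
apply/(ext_op (axioms_op axM)).
apply/(gdim_tres_ext (axioms_op axM) injA (dim L) (m := n)).
apply: absolutely_clean_coresolution => F FP; apply: ext_bidual => //.
by apply: dual_id; apply: pd; apply/level_dualP.
Qed.
End Transfer.

(** * Complexes, resolutions and dimensions *)

Section Complexes.
Variable R : comPzRingType.
Implicit Types A F K L M N X Y : lmodType R.
Let axM := mod_axioms R.

(** Z i is the cokernel of d i, isomorphic to the image of the previous
    differential; it is chosen to be M itself for i = 0. *)
Lemma acyclic_splice (C : int -> lmodType R) (d : forall i, {linear C (i + 1) -> C i})
    M (p : {linear C 0 -> M}) : acyclic d -> is_coker (d 0) p ->
  exists (Z : int -> lmodType R) (f : forall i, {linear Z (i + 1) -> C i})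
    (g : forall i, {linear C i -> Z i}),
  [/\ Z 0 = M, forall i, mses (f i) (g i) & forall i x, d i x = f i (g (i + 1) x)].
Proof.
move=> ac cp.
have ex i : exists X : {X : lmodType R & {linear C i -> X}},
    is_coker (d i) (projT2 X) /\ (i = 0 -> projT1 X = M).
  have [i0|i0] := eqVneq i 0.
    by move: i0 => ->; exists (existT (fun X : lmodType R => {linear C 0 -> X}) M p).
  have [X [q cq]] := coker_ex (d i).
  exists (existT (fun X : lmodType R => {linear C i -> X}) X q).
  by split=> // /eqP; rewrite (negbTE i0).
pose Z i := projT1 (projT1 (cid (ex i))).
pose g i : {linear C i -> Z i} := projT2 (projT1 (cid (ex i))).
have gP i : is_coker (d i) (g i) by have [] := projT2 (cid (ex i)).
have exf i : exists f : {linear Z (i + 1) -> C i}, forall x, f (g (i + 1) x) = d i x.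
  have [sg eg] := gP (i + 1); apply: epi_factor => // x /eg[y <-].
  by apply/ac; exists y.
pose f i := projT1 (cid (exf i)); have fP i : forall x, f i (g (i + 1) x) = d i x.
  exact: projT2 (cid (exf i)).
exists Z, f, g; split=> [|i|i x]; last by rewrite fP.
  by have [_] := projT2 (cid (ex 0)); apply.
have [sg eg] := gP i; have [sg1 eg1] := gP (i + 1); split=> //.
- apply: inj0 => z; have [x <-] := sg1 z; rewrite fP => /ac[y <-].
  by apply/eg1; exists y.
- move=> x; rewrite eg; split=> -[y <-]; first by exists (g (i + 1) y); apply: fP.
  by have [y' <-] := sg1 y; exists y'; rewrite fP.
Qed.

(** A family of short exact sequences indexed by i and i + 1 is spliced without
    any transport between indices. *)
Lemma splice_acyclic (C Z : int -> lmodType R)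
    (f : forall i, {linear Z (i + 1) -> C i}) (g : forall i, {linear C i -> Z i}) :
  (forall i, mses (f i) (g i)) ->
  acyclic (fun i => f i \o g (i + 1)) /\ is_coker (f 0 \o g (0 + 1)) (g 0).
Proof.
move=> fg.
have ex i x : g i x = 0 <-> exists y, (f i \o g (i + 1)) y = x.
  have [fi efg sg] := fg i; have [_ _ sg1] := fg (i + 1).
  rewrite efg; split=> -[y <-]; last by exists (g (i + 1) y).
  by have [z <-] := sg1 y; exists z.
split=> [i x|]; last by split; [have [] := fg 0|apply: ex].
rewrite -ex; have [fi _ _] := fg i; split=> [/= fgx|gx]; last by rewrite /= gx linear0.
by apply: fi; rewrite fgx linear0.
Qed.

Lemma choose_ses (Z : int -> lmodType R) (Q : lmodType R -> Prop) :
  (forall i, exists2 C, Q C & mod_ses (Z (i + 1)) C (Z i)) ->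
  exists (C : int -> lmodType R) (f : forall i, {linear Z (i + 1) -> C i})
    (g : forall i, {linear C i -> Z i}),
    (forall i, Q (C i)) /\ forall i, mses (f i) (g i).
Proof.
move=> ex.
have {}ex (i : int) :
    exists t : {C : lmodType R &
      ({linear Z (i + 1)%R -> C} * {linear C -> Z i})%type},
    Q (projT1 t) /\ mses (projT2 t).1 (projT2 t).2.
  by have [C QC [f [g fg]]] := ex i; exists (existT _ C (f, g)).
pose t i := projT1 (cid (ex i)).
exists (fun i => projT1 (t i)), (fun i => (projT2 (t i)).1), (fun i => (projT2 (t i)).2).
by split=> i; have [] := projT2 (cid (ex i)).
Qed.

Lemma GAC_projectiveP M : GAC_projective M <-> @gac (Mod R) (@level R) M.
Proof.
rewrite (gacZ axM); split.
  move=> [C [d [p [ac pC cp homL]]]].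
  have [Z [f [g [Z0 fg dE]]]] := acyclic_splice ac cp.
  exists Z; split=> // i; split.
    by exists (C i); [apply/projectiveP|exists (f i), (g i)].
  move=> L lL; apply: (mod_orth_of_extend (fg i)); first exact: ((projectiveP _).1 (pC i)).
  move=> h; have [|k kP] := homL L lL i (h \o g (i + 1)).
    by move=> x; rewrite /= dE (mses0 _ (fg (i + 1))) linear0.
  exists k => z; have [_ _ sg] := fg (i + 1); have [x <-] := sg z.
  by rewrite -dE kP.
move=> [Z [Z0 ZP]].
have [|C [f [g [pC fg]]]] := @choose_ses Z (@projective R).
  by move=> i; have [[P pP ZPZ] _] := ZP i; exists P; first exact: ((projectiveP _).2 pP).
have [ac ck] := splice_acyclic fg.
case: M / Z0; exists C, (fun i => f i \o g (i + 1)), (g 0); split=> //.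
move=> L lL i h hd; have [_ ef sg] := fg (i + 1).
have [//|_ /ef[z <-]|k kP] := @epi_factor _ _ _ _ (g (i + 1)) h.
  by have [_ _ sg2] := fg (i + 1 + 1); have [y <-] := sg2 z; apply: hd.
have [l lP] := mod_orth_extend k ((ZP i).2 L lL) (fg i).
by exists l => x; rewrite /= lP kP.
Qed.

(** Complexes are indexed homologically, while the opposite structure reverses
    arrows; hence the negated indices. *)
Lemma GAC_injectiveP M :
  GAC_injective M <-> @gac (op (Mod R)) (@absolutely_clean R) M.
Proof.
rewrite (gacZ (axioms_op axM)); split.
  move=> [C [d [p [ac iC cp homA]]]].
  have [Z [f [g [Z0 fg dE]]]] := acyclic_splice ac cp.
  exists (fun i => Z (- i)); rewrite oppr0; split=> // i; split.
    exists (C (- (i + 1))); first by apply/injectiveP.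
    have -> : - i = - (i + 1) + 1 by rewrite opprD subrK.
    by exists (f (- (i + 1))), (g (- (i + 1))).
  (* Lifting A along the complex at degree j + 1 concerns the cycles in degree
     j + 2, hence Ext^1 of A with the next cycles, in degree j + 3. *)
  move=> A acA; pose j := - i - 1 - 1 - 1.
  have -> : - i = j + 1 + 1 + 1 by rewrite !subrK.
  apply: (mod_orth_of_lift (fg (j + 1 + 1))); first exact: ((injectiveP _).1 (iC _)).
  move=> h; have [|k kP] := homA A acA j (f (j + 1) \o h).
    by move=> x; rewrite /= dE (mses0 _ (fg (j + 1))) linear0.
  exists k => x; have [fi _ _] := fg (j + 1); apply: fi.
  by rewrite -dE kP.
move=> [Z [Z0 ZP]].
have [|C [f [g [iC fg]]]] := @choose_ses (fun i => Z (- i)) (@injective_module R).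
  move=> i; have [[I iI ZIZ] _] := ZP (- (i + 1)).
  by exists I; [exact: ((injectiveP _).2 iI)|move: ZIZ; rewrite opprD subrK].
have [ac ck] := splice_acyclic fg.
have {}Z0 : Z (- 0) = M by rewrite oppr0.
case: M / Z0; exists C, (fun i => f i \o g (i + 1)), (g 0); split=> //.
move=> A acA i h hd; have [_ ef sg] := fg (i + 1).
have [|a|k kP] := @mono_factor _ _ _ _ (f (i + 1)) h; first by have [] := fg (i + 1).
  by apply/ef; have [fi _ _] := fg i; apply: fi; rewrite linear0; apply: hd.
have [l lP] := mod_orth_lift k ((ZP _).2 A acA) (fg (i + 1 + 1)).
by exists l => x; rewrite /= lP kP.
Qed.

Lemma zero_ex : exists O : lmodType R, zero_module O.
Proof.
have [O [f [fi ef]]] := @ker_ex R R^o R^o idfun.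
exists O => x; apply: fi; rewrite linear0.
by apply/(ef (f x)); exists x.
Qed.

Lemma zero_projective X : zero_module X -> projective X.
Proof.
by move=> X0 M N g h _; exists \0 => x; rewrite (X0 x) !linear0.
Qed.

Lemma zero_injective X : zero_module X -> injective_module X.
Proof. by move=> X0 M N g h _; exists \0 => x; rewrite (X0 (h x)). Qed.

Lemma coker_iso (U V X Y : lmodType R) (f : {linear U -> V}) (p : {linear V -> X})
    (h : {linear X -> Y}) : injective h -> surj h -> is_coker f p -> is_coker f (h \o p).
Proof.
move=> hi sh [sp ep]; split=> [y|v].
  by have [x <-] := sh y; have [v <-] := sp x; exists v.
rewrite -ep /=; split=> [hp|->]; last exact: linear0.
by apply: hi; rewrite hp linear0.
Qed.

Lemma GAC_projective_iso X Y (h : {linear X -> Y}) :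
  injective h -> surj h -> GAC_projective X -> GAC_projective Y.
Proof.
move=> hi sh [P [d [p [ac pP cp hL]]]]; exists P, d, (h \o p); split=> //.
exact: coker_iso.
Qed.

Lemma GAC_injective_iso X Y (h : {linear X -> Y}) :
  injective h -> surj h -> GAC_injective X -> GAC_injective Y.
Proof.
move=> hi sh [P [d [p [ac pP cp hL]]]]; exists P, d, (h \o p); split=> //.
exact: coker_iso.
Qed.

Lemma gdim_of_GPac_dim M n : GPac_dim_le M n -> @gdim (Mod R) (@level R) n M.
Proof.
elim: n M => [|n IHn] M [G [d [eps [res gG zG]]]].
  apply/GAC_projectiveP; have [se ee _] := res.
  apply: (GAC_projective_iso (h := eps)) (gG 0%N _) => //.
  apply: inj0 => x /ee[y <-]; by rewrite (zG 1%N _ y) ?linear0.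
have [K [f [q [fe resK _]]]] := resolution_syzygy res.
exists K, (G 0%N); split; first exact/GAC_projectiveP/gG.
  by exists f, eps.
apply: IHn; exists (G \o S), (fun i => d i.+1), q; split=> // i le_i.
  exact: gG i.+1 _.
exact: zG i.+1 _.
Qed.

(** Each step prepends one module to the resolution of the syzygy. *)
Lemma GPac_dim_of_gdim M n : @gdim (Mod R) (@level R) n M -> GPac_dim_le M n.
Proof.
elim: n M => [|n IHn] M /=.
  move=> /GAC_projectiveP gM; have [O O0] := zero_ex.
  pose G i := if i is 0%N then M else O.
  exists G, (fun i => \0), idfun; split=> [|[|i]|[|i]] //.
  split=> [x|x|i x] /=; first by exists x.
    by split=> [->|[y <-] //]; exists 0.
  by split=> // _; exists 0; rewrite (O0 x).
move=> [K [G0 [/GAC_projectiveP gG0 [f [p [fi efp sp]]]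
  /IHn[G [d [eps [[se ee ed] gG zG]]]]]]].
pose G' i := if i is j.+1 then G j else G0.
pose d' i : {linear G' i.+1 -> G' i} :=
  match i with 0%N => f \o eps | j.+1 => d j end.
exists G', d', p; split=> [|[|i]|[|i]] //; [|exact: gG|exact: zG].
split=> // [x|[|i]] /=; last exact: ed.
  rewrite efp; split=> -[y <-]; last by exists (eps y).
  by have [z <-] := se y; exists z.
move=> x; rewrite -ee /=; split=> [fx|->]; last by rewrite linear0.
by apply: fi; rewrite fx linear0.
Qed.

Lemma gdim_of_GIac_dim M n :
  GIac_dim_le M n -> @gdim (op (Mod R)) (@absolutely_clean R) n M.
Proof.
elim: n M => [|n IHn] M [G [d [eta [[ei ee ed] gG zG]]]].
  have [//|x|q qP] := @mono_factor _ _ _ _ eta (idfun : {linear G 0%N -> G 0%N}).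
    by apply/ee; apply: zG 1%N _ _.
  apply/GAC_injectiveP; apply: (GAC_injective_iso (h := q)) (gG 0%N _) => //.
    by apply: (can_inj (g := eta)).
  by move=> m; exists (eta m); apply: ei; rewrite qP.
have [K [p [sp ep]]] := coker_ex eta.
exists K, (G 0%N); split; first exact/GAC_injectiveP/gG.
  by exists eta, p.
have [//|x /ep/ee //|q qP] := @epi_factor _ _ _ _ p (d 0%N).
apply: IHn; exists (G \o S), (fun i => d i.+1), q; split=> [|i le_i|i le_i].
- split=> [|x|i]; last exact: ed.
    apply: inj0 => k; have [x <-] := sp k; rewrite qP => dx.
    exact/ep/ee.
  rewrite (ed 0%N x); split=> -[y <-]; first by exists (p y).
  by have [z <-] := sp y; exists z; rewrite qP.
- exact: gG i.+1 _.
- exact: zG i.+1 _.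
Qed.

Lemma GIac_dim_of_gdim M n :
  @gdim (op (Mod R)) (@absolutely_clean R) n M -> GIac_dim_le M n.
Proof.
elim: n M => [|n IHn] M /=.
  move=> /GAC_injectiveP gM; have [O O0] := zero_ex.
  pose G i := if i is 0%N then M else O.
  exists G, (fun i => \0), idfun; split=> [|[|i]|[|i]] //.
  split=> [x //|x|i x] /=; first by split=> // _; exists x.
  by split=> // _; exists 0; rewrite (O0 x).
move=> [K [G0 [/GAC_injectiveP gG0 [f [p [fi efp sp]]]
  /IHn[G [d [eta [[ei ee ed] gG zG]]]]]]].
pose G' i := if i is j.+1 then G j else G0.
pose d' i : {linear G' i -> G' i.+1} :=
  match i with 0%N => eta \o p | j.+1 => d j end.
exists G', d', f; split=> [|[|i]|[|i]] //; [|exact: gG|exact: zG].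
split=> // [x|[|i]] /=; last exact: ed.
  rewrite -efp /=; split=> [ex|->]; last by rewrite linear0.
  by apply: ei; rewrite ex linear0.
move=> x; rewrite ee; split=> -[y <-]; last by exists (p y).
by have [z <-] := sp y; exists z.
Qed.

Lemma GPac_dim_le_mono M m n : (m <= n)%N -> GPac_dim_le M m -> GPac_dim_le M n.
Proof.
move=> mn [G [d [eps [res gG zG]]]]; exists G, d, eps; split=> // i le_i.
  have [/gG //|/zG/zero_projective/projectiveP pG] := leqP i m.
  exact/GAC_projectiveP/(gac_proj axM).
by apply: zG; apply: leq_ltn_trans le_i.
Qed.

Lemma GIac_dim_le_mono M m n : (m <= n)%N -> GIac_dim_le M m -> GIac_dim_le M n.
Proof.
move=> mn [G [d [eps [res gG zG]]]]; exists G, d, eps; split=> // i le_i.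
  have [/gG //|/zG/zero_injective/injectiveP iG] := leqP i m.
  exact/GAC_injectiveP/(gac_proj (axioms_op axM)).
by apply: zG; apply: leq_ltn_trans le_i.
Qed.
End Complexes.

Lemma dim_leq_least (P : nat -> Prop) n :
  (forall m, (m <= n)%N -> P m -> P n) -> dim_leq (least P) n <-> P n.
Proof.
move=> mono; rewrite /least; case: pselect => [exP|noP] /=; last first.
  by split=> // Pn; case: noP; exists n; apply/asboolP.
case: ex_minnP => k /asboolP Pk kmin; split=> [kn|Pn]; first exact: mono Pk.
exact/kmin/asboolP.
Qed.

Theorem theorem1p4 (R : comPzRingType) : GIac_gldim R = GPac_gldim R.
Proof.
congr least; apply/funext => n; apply/propext.
have GP (M : lmodType R) : dim_leq (GPac_dim M) n <-> @gdim (Mod R) (@level R) n M.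
  rewrite dim_leq_least => [|m mn]; last exact: GPac_dim_le_mono.
  by split; [apply: gdim_of_GPac_dim|apply: GPac_dim_of_gdim].
have GI (M : lmodType R) :
    dim_leq (GIac_dim M) n <-> @gdim (op (Mod R)) (@absolutely_clean R) n M.
  rewrite dim_leq_least => [|m mn]; last exact: GIac_dim_le_mono.
  by split; [apply: gdim_of_GIac_dim|apply: GIac_dim_of_gdim].
split=> h M.
  by apply/GP; apply: (gdim_transfer R n).2 => X; apply/GI.
by apply/GI; apply: (gdim_transfer R n).1 => X; apply/GP.
Qed.
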